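(* For each real $m>0$ there are $4$-dimensional solvable Lie groups $G$ carrying left invariant Riemannian metrics $g$ such that, for some $\lambda\in\mathbb{R}$ and some smooth function $w$ on $G$, $(G,g,w)$ is a $(\lambda,4+m)$-Einstein manifold that is not rigid.
   Context: For real $m>0$, $\lambda\in\mathbb{R}$ and an integer $n\ge 1$, a $(\lambda,n+m)$-Einstein manifold $(M^n,g,w)$ is a complete connected Riemannian manifold $(M^n,g)$, possibly with boundary, together with a smooth function $w$ on $M$ such that $\mathrm{Hess}\,w=\frac{w}{m}(\mathrm{Ric}-\lambda g)$, $w>0$ on $\mathrm{int}(M)$ and $w=0$ on $\partial M$; when $m=1$ one additionally requires $\Delta w=-\lambda w$. It is called rigid if $(M,g)$ is Einstein or its universal cover is a (Riemannian) product of Einstein manifolds. Einstein means $\mathrm{Ric}=c\,g$ for a constant $c$; one-dimensional manifolds count as Einstein with $c=0$. *)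

(* Defs.v *)
From HB Require Import structures.
From mathcomp Require Import all_boot all_order all_algebra.
From mathcomp Require Import all_classical all_reals all_analysis.

Set Implicit Arguments.
Unset Strict Implicit.
Unset Printing Implicit Defensive.
Import Order.TTheory GRing.Theory Num.Theory.
Import numFieldNormedType.Exports.

Local Open Scope classical_set_scope.
Local Open Scope ring_scope.

(* ---------- Smooth functions on subsets of R^n ---------- *)

Definition pd (R : realType) (n : nat) (V : normedModType R) (a : 'I_n)
  (f : 'rV[R]_n -> V) : 'rV[R]_n -> V :=
  fun x => 'D_(delta_mx 0 a) f x.

(* C^oo on an open set U: all iterated partial derivatives are (Frechet)
   differentiable, hence also continuous, on U. *)
Definition smooth_on (R : realType) (n : nat) (V : normedModType R)
  (U : set 'rV[R]_n) (f : 'rV[R]_n -> V) : Prop :=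
  forall (s : seq 'I_n) (x : 'rV[R]_n), U x ->
    differentiable (foldr (fun a h => pd a h) f s) x.

(* ---------- Manifolds (without boundary) ---------- *)

(* The data of an atlas; the axioms are in is_manifold.  The functions [coords]
   and [param] are total, but only meaningful on [dom i] and on its image. *)
Record atlas (R : realType) (n : nat) := Atlas {
  carrier :> topologicalType;
  chart : Type;
  dom : chart -> set carrier;
  coords : chart -> carrier -> 'rV[R]_n;
  param : chart -> 'rV[R]_n -> carrier }.

Arguments Atlas {R n carrier chart} dom coords param.
Arguments chart {R n} M : rename.
Arguments dom {R n} M i : rename.
Arguments coords {R n} M i : rename.
Arguments param {R n} M i : rename.

Definition image_of (R : realType) (n : nat) (M : atlas R n) (i : chart M) :
  set 'rV[R]_n := coords M i @` dom M i.

Definition is_manifold (R : realType) (n : nat) (M : atlas R n) : Prop :=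
  [/\ hausdorff_space M,
      @second_countable M,
      forall p : M, exists i : chart M, dom M i p,
      forall i : chart M,
        [/\ open (dom M i),
            open (image_of i),
            forall p, dom M i p -> param M i (coords M i p) = p,
            forall p, dom M i p -> {for p, continuous (coords M i)} &
            forall x, image_of i x -> {for x, continuous (param M i)}] &
      forall i j : chart M,
        smooth_on (coords M i @` (dom M i `&` dom M j))
          (coords M j \o param M i)].

Definition smooth_map (R : realType) (n k : nat) (M : atlas R n)
  (N : atlas R k) (f : M -> N) : Prop :=
  continuous f /\
  forall (i : chart M) (j : chart N),
    smooth_on (coords M i @` (dom M i `&` f @^-1` dom N j))
      (coords N j \o f \o param M i).

Definition smooth_fun (R : realType) (n : nat) (M : atlas R n) (w : M -> R) :
  Prop :=
  forall i : chart M, smooth_on (image_of i) (w \o param M i).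

Definition prod_atlas (R : realType) (n k : nat) (M : atlas R n)
  (N : atlas R k) : atlas R (n + k) :=
  @Atlas R (n + k) (M * N)%type (chart M * chart N)%type
    (fun c => dom M c.1 `*` dom N c.2)
    (fun c p => row_mx (coords M c.1 p.1) (coords N c.2 p.2))
    (fun c v => (param M c.1 (lsubmx v), param N c.2 (rsubmx v))).

(* ---------- Riemannian metrics ---------- *)

(* A metric is given by its coordinate matrices (g_ab) in each chart. *)
Definition metric (R : realType) (n : nat) (M : atlas R n) : Type :=
  chart M -> 'rV[R]_n -> 'M[R]_n.

(* f^* h = g.  In the library's row vector convention, the differential of a
   map F between coordinate spaces is v |-> v *m 'J F x. *)
Definition pullback_eq (R : realType) (n k : nat) (M : atlas R n)
  (N : atlas R k) (g : metric M) (h : metric N) (f : M -> N) : Prop :=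
  forall (i : chart M) (j : chart N) (p : M), dom M i p -> dom N j (f p) ->
    let J := jacobian (coords N j \o f \o param M i) (coords M i p) in
    g i (coords M i p) = J *m h j (coords N j (f p)) *m J^T.

Definition isometric_map (R : realType) (n k : nat) (M : atlas R n)
  (N : atlas R k) (g : metric M) (h : metric N) (f : M -> N) : Prop :=
  smooth_map f /\ pullback_eq g h f.

(* The last clause is the tensor transformation law between charts. *)
Definition is_metric (R : realType) (n : nat) (M : atlas R n) (g : metric M) :
  Prop :=
  [/\ forall (i : chart M) x, image_of i x -> (g i x)^T = g i x,
      forall (i : chart M) x (v : 'rV[R]_n), image_of i x -> v != 0 ->
        0 < (v *m g i x *m v^T) 0 0,
      forall (i : chart M) (a b : 'I_n),
        smooth_on (image_of i) (fun x => g i x a b) &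
      pullback_eq g g (fun p : M => p)].

Definition riemannian (R : realType) (n : nat) (M : atlas R n)
  (g : metric M) : Prop := is_manifold M /\ is_metric g.

Definition isometric (R : realType) (n k : nat) (M : atlas R n)
  (N : atlas R k) (g : metric M) (h : metric N) : Prop :=
  exists (f : M -> N) (f' : N -> M),
    [/\ cancel f f', cancel f' f, isometric_map g h f & smooth_map f'].

Definition prod_metric (R : realType) (n k : nat) (M : atlas R n)
  (N : atlas R k) (g : metric M) (h : metric N) : metric (prod_atlas M N) :=
  fun c v => block_mx (g c.1 (lsubmx v)) 0 0 (h c.2 (rsubmx v)).

(* ---------- Riemannian distance and completeness ---------- *)

(* C^1 curves are taken on all of R and only used on [0, 1].  Their velocity
   may vanish, so that corners can be removed by reparametrization: the
   infimum of lengths is the same as over piecewise C^1 curves. *)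
Definition c1_curve (R : realType) (n : nat) (M : atlas R n) (c : R -> M) :
  Prop :=
  continuous c /\
  forall (t : R) (i : chart M), dom M i (c t) ->
    derivable (coords M i \o c) t 1 /\
    {for t, continuous (derive1 (coords M i \o c))}.

Definition is_speed (R : realType) (n : nat) (M : atlas R n) (g : metric M)
  (c : R -> M) (s : R -> R) : Prop :=
  forall (t : R) (i : chart M), dom M i (c t) ->
    let v := derive1 (coords M i \o c) t in
    s t = Num.sqrt ((v *m g i (coords M i (c t)) *m v^T) 0 0).

Definition rdist (R : realType) (n : nat) (M : atlas R n) (g : metric M)
  (p q : M) : \bar R :=
  ereal_inf [set l : \bar R | exists (c : R -> M) (s : R -> R),
    [/\ c1_curve c, c 0 = p, c 1 = q, is_speed g c s &
        l = (\int[lebesgue_measure]_(t in `[0%R, 1%R]) (s t)%:E)%E]].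

Definition complete_metric (R : realType) (n : nat) (M : atlas R n)
  (g : metric M) : Prop :=
  forall u : nat -> M,
    (forall e : R, 0 < e -> exists N : nat, forall k l : nat,
       (N <= k)%N -> (N <= l)%N -> (rdist g (u k) (u l) < e%:E)%E) ->
    exists x : M, forall e : R, 0 < e -> exists N : nat, forall k : nat,
      (N <= k)%N -> (rdist g (u k) x < e%:E)%E.

(* ---------- Curvature, Hessian and Laplacian in coordinates ---------- *)

(* Gamma^k_ab *)
Definition christoffel (R : realType) (n : nat) (g : 'rV[R]_n -> 'M[R]_n)
  (k a b : 'I_n) (x : 'rV[R]_n) : R :=
  2^-1 * \sum_(l < n) invmx (g x) k l *
    (pd a (fun y => g y b l) x + pd b (fun y => g y a l) x
     - pd l (fun y => g y a b) x).

(* Ric_ab = d_k Gamma^k_ab - d_b Gamma^k_ak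
            + Gamma^k_kl Gamma^l_ab - Gamma^k_bl Gamma^l_ak *)
Definition ricci (R : realType) (n : nat) (g : 'rV[R]_n -> 'M[R]_n)
  (a b : 'I_n) (x : 'rV[R]_n) : R :=
  \sum_(k < n) (pd k (christoffel g k a b) x - pd b (christoffel g k a k) x)
  + \sum_(k < n) \sum_(l < n)
      (christoffel g k k l x * christoffel g l a b x
       - christoffel g k b l x * christoffel g l a k x).

Definition hess (R : realType) (n : nat) (g : 'rV[R]_n -> 'M[R]_n)
  (f : 'rV[R]_n -> R) (a b : 'I_n) (x : 'rV[R]_n) : R :=
  pd a (pd b f) x - \sum_(k < n) christoffel g k a b x * pd k f x.

Definition laplacian (R : realType) (n : nat) (g : 'rV[R]_n -> 'M[R]_n)
  (f : 'rV[R]_n -> R) (x : 'rV[R]_n) : R :=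
  \sum_(a < n) \sum_(b < n) invmx (g x) a b * hess g f a b x.

Definition einstein (R : realType) (n : nat) (M : atlas R n) (g : metric M) :
  Prop :=
  exists c : R, forall (i : chart M) (x : 'rV[R]_n) (a b : 'I_n),
    image_of i x -> ricci (g i) a b x = c * g i x a b.

(* (lam, n+m)-Einstein manifolds.  Manifolds here have empty boundary, so that
   int(M) = M and the condition w = 0 on the boundary is void. *)
Definition lam_einstein (R : realType) (lam m : R) (n : nat) (M : atlas R n)
  (g : metric M) (w : M -> R) : Prop :=
  [/\ [/\ (0 < n)%N, riemannian g, connected [set: M] & complete_metric g],
      smooth_fun w,
      forall (i : chart M) (x : 'rV[R]_n) (a b : 'I_n), image_of i x ->
        hess (g i) (w \o param M i) a b x =
        w (param M i x) / m * (ricci (g i) a b x - lam * g i x a b),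
      forall p : M, 0 < w p &
      m = 1 -> forall (i : chart M) (x : 'rV[R]_n), image_of i x ->
        laplacian (g i) (w \o param M i) x = - lam * w (param M i x)].

(* ---------- Universal covers and rigidity ---------- *)

Definition simply_connected (R : realType) (T : topologicalType) : Prop :=
  (forall p q : T, exists c : R -> T,
     [/\ {within `[0, 1], continuous c}, c 0 = p & c 1 = q]) /\
  (forall c : R -> T, {within `[0, 1], continuous c} -> c 0 = c 1 ->
     exists H : R * R -> T,
       [/\ {within `[0, 1] `*` `[0, 1], continuous H},
           forall t : R, t \in `[0, 1] -> H (0, t) = c t,
           forall t : R, t \in `[0, 1] -> H (1, t) = c 0 &
           forall s : R, s \in `[0, 1] -> H (s, 0) = c 0 /\ H (s, 1) = c 0]).

Definition covering_map (T S : topologicalType) (p : T -> S) : Prop :=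
  [/\ continuous p,
      forall y : S, exists x : T, p x = y &
      forall y : S, exists (U : set S) (I : Type) (V : I -> set T),
        [/\ open U, U y, p @^-1` U = \bigcup_i V i, trivIset setT V &
            forall i : I, open (V i) /\
              exists q : S -> T,
                [/\ forall z, U z -> {for z, continuous q},
                    forall z, U z -> V i (q z) /\ p (q z) = z &
                    forall x, V i x -> q (p x) = x]]].

Definition universal_cover (R : realType) (n : nat) (M : atlas R n)
  (g : metric M) (M' : atlas R n) (g' : metric M') : Prop :=
  [/\ riemannian g', simply_connected R M' &
      exists p : M' -> M, covering_map p /\ isometric_map g' g p].

Inductive einstein_product (R : realType) :
  forall (n : nat) (M : atlas R n), metric M -> Prop :=
| Einstein_factor (n : nat) (M : atlas R n) (g : metric M) :
    riemannian g -> einstein g -> einstein_product g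
| Einstein_times (n k : nat) (M : atlas R n) (N : atlas R k)
    (g : metric M) (h : metric N) :
    einstein_product g -> riemannian h -> einstein h ->
    einstein_product (prod_metric g h).

Definition rigid (R : realType) (n : nat) (M : atlas R n) (g : metric M) :
  Prop :=
  einstein g \/
  exists (M' : atlas R n) (g' : metric M') (k : nat) (P : atlas R k)
    (h : metric P),
    [/\ universal_cover g g', einstein_product h & isometric g' h].

(* ---------- Lie groups ---------- *)

Definition is_group (G : Type) (mul : G -> G -> G) (inv : G -> G) (e : G) :
  Prop := [/\ associative mul, left_id e mul & left_inverse e inv mul].

Definition lie_group (R : realType) (n : nat) (G : atlas R n)
  (mul : G -> G -> G) (inv : G -> G) (e : G) : Prop :=
  [/\ is_manifold G, is_group mul inv e,
      smooth_map (fun p : prod_atlas G G => mul p.1 p.2) & smooth_map inv].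

Definition is_subgroup (G : Type) (mul : G -> G -> G) (inv : G -> G) (e : G)
  (H : set G) : Prop :=
  [/\ H e, forall x y, H x -> H y -> H (mul x y) & forall x, H x -> H (inv x)].

Definition commutator_subgroup (G : Type) (mul : G -> G -> G) (inv : G -> G)
  (e : G) (A : set G) : set G :=
  [set z | forall H : set G, is_subgroup mul inv e H ->
     (forall x y, A x -> A y -> H (mul (mul x y) (mul (inv x) (inv y)))) ->
     H z].

Definition solvable_group (G : Type) (mul : G -> G -> G) (inv : G -> G)
  (e : G) : Prop :=
  exists k : nat,
    iter k (commutator_subgroup mul inv e) setT `<=` [set e].

Definition left_invariant (R : realType) (n : nat) (G : atlas R n)
  (mul : G -> G -> G) (g : metric G) : Prop :=
  forall a : G, isometric_map g g (mul a).

(* Main.v *)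
From HB Require Import structures.
Require Import Defs.
From mathcomp Require Import all_boot all_order all_algebra.
From mathcomp Require Import all_classical all_reals all_analysis.
From mathcomp Require Import measurable_realfun.
From mathcomp Require Import zify ring lra.
Set Implicit Arguments.
Unset Strict Implicit.
Unset Printing Implicit Defensive.
Import Order.TTheory GRing.Theory Num.Theory.
Import numFieldNormedType.Exports.
Local Open Scope classical_set_scope.
Local Open Scope ring_scope.

(** The example is the metric
      g = A du^2 + e^(2u) (dx^2 + dy^2) + e^(4u) (dz - x dy)^2,  A = 4 + 3 m / 2,
    with w = e^(3u/2) and lambda = - 3/2. It lives on the group obtained when
    the real line acts on the three-dimensional Heisenberg group by dilations.
    For A = 4 this is the complex hyperbolic plane, which is Einstein; stretching
    the line direction keeps the Ricci tensor diagonal in the same frame, and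
    then the Hessian of a power of e^u can make up for the difference between
    Ric and lambda g. The Christoffel symbols and the Ricci tensor are explicit
    exponential polynomials ([heis_christoffel], [heis_ricci]), so that the
    Einstein equation for w is an identity between such expressions
    ([heis_hess], [heis_laplacian]).

    Rigidity fails because of the multiplicities of Ricci eigenvalues. On a
    product of Einstein manifolds each factor contributes its Einstein constant
    with multiplicity its dimension. A simple eigenvalue therefore comes from a
    one-dimensional factor, and these are Ricci flat: a nonzero eigenvalue is
    never simple ([einstein_product_eigenvalue]). For g, however, the direction
    of u has the simple eigenvalue - 6/A ([heis_simple_eigenvalue]). To compare
    the two through a universal cover one needs that the Ricci tensor is natural
    under local isometries ([ricci_pullback]). The connection of a pulled back
    metric is the gauge transform of the original one by the Jacobian
    ([gam_gauge]), since it is again symmetric and compatible ([gam_unique]);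
    curvature then transforms by conjugation. This uses the symmetry of second
    derivatives ([pd_comm]). The same uniqueness argument shows that the Ricci
    tensor of a product is block diagonal ([ricm_prod]).

    Completeness is checked by comparing distances with the coordinate norm on
    bounded regions ([complete_criterion]): a curve of length at most one moves
    u by at most one, after which all coefficients of the metric are under
    control ([heis_lower], [heis_upper]). *)

(** * Partial derivatives *)

Lemma littleo_mod (R : realType) n (V : normedModType R) (u v : 'rV[R]_n -> V) :
  (u = v +o_ (0 : 'rV[R]_n) id) <-> forall e, 0 < e ->
    \forall h \near (0 : 'rV[R]_n), `|u h - v h| <= e * `|h|.
Proof. exact: (@eqaddoP R 'rV[R]_n V 'rV[R]_n _ u v id). Qed.

Lemma near_eq_differentiable (R : realType) n (V : normedModType R)
    (f g : 'rV[R]_n -> V) x :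
  (\near x, f x = g x) -> differentiable f x -> differentiable g x.
Proof.
move=> fg df.
have fgx : f x = g x by exact: nbhs_singleton fg.
have [cdf fE] := (diff_locallyP _ _).1 df.
have gE : g \o shift x = cst (g x) + 'd f x +o_ 0 id.
  apply/littleo_mod => e e0; have /littleo_mod/(_ _ e0) := fE.
  have fg0 : \forall h \near 0, f (h + x) = g (h + x).
    move: fg; rewrite (near_shift 0 x) => fg; near=> h.
    suff : (fun y => f y = g y) (h + x - 0) by rewrite subr0.
    by rewrite -addrA; near: h.
  move=> H; near=> h.
  have -> : (g \o shift x) h = (f \o shift x) h by rewrite /= -(near fg0 h).
  by rewrite fctE -fgx; near: h.
by apply/diff_locallyP; rewrite (diff_unique cdf gE).
Unshelve. all: by end_near. Qed.

Section PartialDerivatives.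
Context {R : realType} {n : nat}.
Implicit Types (f g : 'rV[R]_n -> R) (x : 'rV[R]_n) (a : 'I_n).

Lemma pdE (V : normedModType R) (f : 'rV[R]_n -> V) a x :
  differentiable f x -> pd a f x = 'd f x (delta_mx 0 a).
Proof. exact: deriveE. Qed.

Lemma near_eq_pd (V : normedModType R) (f g : 'rV[R]_n -> V) a x :
  (\near x, f x = g x) -> pd a f x = pd a g x.
Proof. exact: near_eq_derive. Qed.

Lemma open_eq_pd (V : normedModType R) (U : set 'rV[R]_n)
    (f g : 'rV[R]_n -> V) a x :
  open U -> U x -> (forall y, U y -> f y = g y) -> pd a f x = pd a g x.
Proof.
move=> oU Ux fg; apply: near_eq_pd.
by apply: filterS (open_nbhs_nbhs (conj oU Ux)) => y; exact: fg.
Qed.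

Lemma eq_pd (V : normedModType R) (f g : 'rV[R]_n -> V) a x :
  f =1 g -> pd a f x = pd a g x.
Proof. by move=> /funext ->. Qed.

Lemma pdD f g a x : differentiable f x -> differentiable g x ->
  pd a (fun y => f y + g y) x = pd a f x + pd a g x.
Proof. by move=> df dg; apply: deriveD; exact: diff_derivable. Qed.

Lemma pdM f g a x : differentiable f x -> differentiable g x ->
  pd a (fun y => f y * g y) x = pd a f x * g x + f x * pd a g x.
Proof.
move=> df dg; rewrite /pd deriveM; [|exact: diff_derivable..].
by rewrite addrC mulrC.
Qed.

Lemma pd_cst (V : normedModType R) (c : V) a x : pd a (fun=> c) x = 0.
Proof. exact: derive_cst. Qed.

Lemma pd_coord b a x : pd a (fun y : 'rV[R]_n => y 0 b : R) x = (a == b)%:R.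
Proof.
have @f : {linear 'rV[R]_n -> R}.
  by exists (fun N : 'rV[R]_n => N 0 b); do 2![eexists]; do ?[constructor];
     rewrite ?mxE// => ? *; rewrite ?mxE//; move=> ?; rewrite !mxE.
rewrite pdE; last exact: differentiable_coord.
have -> : (fun y : 'rV[R]_n => y 0 b : R) = f by [].
by rewrite diff_lin /= ?mxE 1?eq_sym //; exact: coord_continuous.
Qed.

Lemma differentiable_sumf (I : Type) (s : seq I) (P : pred I)
    (F : I -> 'rV[R]_n -> R) x :
  (forall i, P i -> differentiable (F i) x) ->
  differentiable (fun y => \sum_(i <- s | P i) F i y) x.
Proof.
move=> dF.
have <- : \sum_(i <- s | P i) F i = fun y => \sum_(i <- s | P i) F i y.
  by apply/funext => y; rewrite fct_sumE.
by elim/big_ind : _ => // ? ? g h; exact: differentiableD.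
Qed.

Lemma pd_sum (I : Type) (s : seq I) (P : pred I) (F : I -> 'rV[R]_n -> R) a x :
  (forall i, P i -> differentiable (F i) x) ->
  pd a (fun y => \sum_(i <- s | P i) F i y) x =
  \sum_(i <- s | P i) pd a (F i) x.
Proof.
move=> dF; elim: s => [|i s IH].
  rewrite big_nil -[RHS](pd_cst (0 : R) a x).
  by apply: eq_pd => y; rewrite big_nil.
rewrite big_cons -IH; case: ifPn => Pi; last first.
  by apply: eq_pd => y; rewrite big_cons (negbTE Pi).
rewrite -pdD; [|exact: dF|exact: differentiable_sumf].
by apply: eq_pd => y; rewrite big_cons Pi.
Qed.

Lemma differentiable_prodf (I : Type) (s : seq I) (P : pred I)
    (F : I -> 'rV[R]_n -> R) x :
  (forall i, P i -> differentiable (F i) x) ->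
  differentiable (fun y => \prod_(i <- s | P i) F i y) x.
Proof.
move=> dF; elim: s => [|i s IH].
  have -> : (fun y => \prod_(i <- [::] | P i) F i y) = cst 1.
    by apply/funext => y; rewrite big_nil.
  exact: differentiable_cst.
have -> : (fun y => \prod_(j <- i :: s | P j) F j y) =
    (if P i then fun y => F i y * \prod_(j <- s | P j) F j y
     else fun y => \prod_(j <- s | P j) F j y).
  by apply/funext => y; rewrite big_cons; case: ifP.
by case: ifPn => // Pi; apply: differentiableM => //; exact: dF.
Qed.

End PartialDerivatives.

Lemma pd_comp (R : realType) n k (h : 'rV[R]_k -> R)
    (F : 'rV[R]_n -> 'rV[R]_k) a x :
  differentiable F x -> differentiable h (F x) ->
  pd a (h \o F) x = \sum_c pd a (fun y => F y 0 c) x * pd c h (F x).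
Proof.
move=> dF dh; rewrite pdE; last exact: differentiable_comp.
rewrite diff_comp //= -pdE //.
rewrite [pd a F x]row_sum_delta linear_sum /=; apply: eq_bigr => c _.
rewrite linearZ /= -(pdE c dh); congr (_ * _).
rewrite /pd derive_mx; last exact: diff_derivable.
by rewrite mxE.
Qed.

(** Given by scalar partial derivatives instead of the differential, so that
    its entries can be differentiated further without side conditions. *)
HB.lock Definition jac (R : realType) n k (F : 'rV[R]_n -> 'rV[R]_k)
    (x : 'rV[R]_n) : 'M[R]_(n, k) :=
  \matrix_(a, c) pd a (fun y => F y 0 c) x.

Lemma jacE (R : realType) n k (F : 'rV[R]_n -> 'rV[R]_k) x a c :
  jac F x a c = pd a (fun y => F y 0 c) x.
Proof. by rewrite jac.unlock mxE. Qed.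

Lemma jacobianE (R : realType) n k (F : 'rV[R]_n -> 'rV[R]_k) x :
  differentiable F x -> jacobian F x = jac F x.
Proof.
move=> dF; apply/matrixP => a c; rewrite jacE !mxE /=.
rewrite -deriveE // derive_mx; last exact: diff_derivable.
by rewrite mxE.
Qed.

Lemma jac_comp (R : realType) n k l (G : 'rV[R]_k -> 'rV[R]_l)
    (F : 'rV[R]_n -> 'rV[R]_k) x :
  differentiable F x -> differentiable G (F x) ->
  jac (G \o F) x = jac F x *m jac G (F x).
Proof.
move=> dF dG; apply/matrixP => a c; rewrite jacE !mxE.
rewrite (pd_comp (h := fun z => G z 0 c)) //; last first.
  by apply: (@differentiable_comp _ _ _ _ G (fun z => z 0 c)) => //;
     exact: differentiable_coord.
by apply: eq_bigr => b _; rewrite !jacE.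
Qed.

Lemma jac_id (R : realType) n (x : 'rV[R]_n) : jac id x = 1%:M.
Proof. by apply/matrixP => a c; rewrite jacE !mxE pd_coord. Qed.

(** * Symmetry of second derivatives *)

Section Schwarz.
Context {R : realType} {n : nat}.
Implicit Types (f : 'rV[R]_n -> R) (x : 'rV[R]_n) (a b : 'I_n).

Lemma is_derive_line f (v w : 'rV[R]_n) (s : R) :
  differentiable f (s *: v + w) ->
  is_derive s 1 (fun t => f (t *: v + w)) ('D_v f (s *: v + w)).
Proof.
move=> /diff_derivable df.
have E : (fun h : R => h^-1 *: (((fun t => f (t *: v + w)) \o shift s) (h *: 1)
            - f (s *: v + w))) =
         (fun h : R => h^-1 *: ((f \o shift (s *: v + w)) (h *: v)
            - f (s *: v + w))).
  apply/funext => h /=; congr (_ *: (f _ - _)).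
  by rewrite [_ *: 1]mulr1 scalerDl addrA.
apply: DeriveDef; first by rewrite /derivable E; exact: df.
by rewrite /derive E.
Qed.

Lemma norm_delta_mx_le1 a : `|delta_mx 0 a : 'rV[R]_n| <= 1.
Proof.
rewrite [leLHS]/Num.Def.normr/= mx_normrE.
apply: bigmax_le => // i _; rewrite mxE normr_nat lern1.
by case: (_ && _).
Qed.

Definition second_difference f a b x (h : R) :=
  f (h *: delta_mx 0 a + (h *: delta_mx 0 b + x)) - f (h *: delta_mx 0 a + x)
  - f (h *: delta_mx 0 b + x) + f x.

(** By the mean value theorem in the direction a, the second difference is h
    times an increment of the partial derivative in the direction a, and
    differentiability of the latter at x evaluates that increment. *)
Lemma second_difference_approx f a b x :
  (\forall y \near x, differentiable f y) -> differentiable (pd a f) x ->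
  forall e : R, 0 < e -> \forall h \near 0^'+,
    `|second_difference f a b x h - h ^+ 2 * pd b (pd a f) x|
      <= e * h ^+ 2.
Proof.
move=> df da e e0.
(* The two evaluation points are within 2 h and h of x. *)
have e3 : 0 < e / 3 by rewrite divr_gt0.
have [_ dE] := (diff_locallyP _ _).1 da.
move/littleo_mod : dE => /(_ _ e3) dE.
move: df; rewrite (near_shift 0 x) subr0 => df.
have /nbhs_ballP[d /= d0 H] : \forall v \near (0 : 'rV[R]_n),
    differentiable f (v + x) /\
    `|pd a f (v + x) - (pd a f x + 'd (pd a f) x v)| <= e / 3 * `|v|.
  exact: filterI df dE.
near=> h.
have h0 : 0 < h by [].
have hd : 2 * h < d.
  rewrite mulrC -ltr_pdivlMr //; near: h; apply: nbhs_right_lt.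
  by rewrite divr_gt0.
have nle (s t : R) : 0 <= s <= h -> 0 <= t <= h ->
    `|s *: (delta_mx 0 a : 'rV[R]_n) + t *: delta_mx 0 b| <= 2 * h.
  move=> /andP[s0 sh] /andP[t0 th].
  rewrite (le_trans (ler_normD _ _))// mulr_natl mulr2n !normrZ.
  by apply: lerD; rewrite ger0_norm //;
     apply: (le_trans (ler_wpM2l _ (norm_delta_mx_le1 _))); rewrite ?mulr1.
have nH (s t : R) : 0 <= s <= h -> 0 <= t <= h ->
   differentiable f (s *: delta_mx 0 a + (t *: delta_mx 0 b + x)) /\
   `|pd a f (s *: delta_mx 0 a + (t *: delta_mx 0 b + x)) - (pd a f x +
     'd (pd a f) x (s *: delta_mx 0 a + t *: delta_mx 0 b))| <=
     e / 3 * `|s *: (delta_mx 0 a : 'rV[R]_n) + t *: delta_mx 0 b|.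
  move=> sh th; rewrite addrA; apply: H.
  by rewrite -ball_normE /= sub0r normrN (le_lt_trans (nle _ _ sh th)).
have h00 : 0 <= h <= h by apply/andP; split; [exact: ltW|].
have z00 : 0 <= (0 : R) <= h by apply/andP; split; [exact: lexx|exact: ltW].
pose phi (s : R) := f (s *: delta_mx 0 a + (h *: delta_mx 0 b + x))
                    - f (s *: delta_mx 0 a + x).
pose dphi (s : R) := pd a f (s *: delta_mx 0 a + (h *: delta_mx 0 b + x))
                    - pd a f (s *: delta_mx 0 a + x).
have dphiE (s : R) : 0 <= s <= h -> is_derive s 1 phi (dphi s).
  move=> sh; apply: is_deriveB; apply: is_derive_line.
    by have [] := nH s h sh h00.
  by have [] := nH s 0 sh z00; rewrite scale0r add0r.
have [s sh sE] : exists2 c, c \in `]0, h[ & phi h - phi 0 = dphi c * (h - 0).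
  apply: MVT => //.
    by move=> s; rewrite in_itv /= => /andP[s0 sh]; apply: dphiE; rewrite !ltW.
  apply: derivable_within_continuous => s; rewrite in_itv /= => sh.
  by have [] := dphiE _ sh.
move: sh; rewrite in_itv /= => /andP[s0 slth].
have sh : 0 <= s <= h by rewrite !ltW.
have -> : second_difference f a b x h = h * dphi s.
  by rewrite mulrC -[X in _ * X](subr0 h) -sE /phi /second_difference scale0r
     !add0r; ring.
have [_ H1] := nH s h sh h00.
have [_] := nH s 0 sh z00; rewrite scale0r addr0 add0r => H2.
have -> : h * dphi s - h ^+ 2 * pd b (pd a f) x = h * (
  (pd a f (s *: delta_mx 0 a + (h *: delta_mx 0 b + x)) - (pd a f x +
     'd (pd a f) x (s *: delta_mx 0 a + h *: delta_mx 0 b))) -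
  (pd a f (s *: delta_mx 0 a + x) - (pd a f x +
     'd (pd a f) x (s *: delta_mx 0 a)))).
  have -> : 'd (pd a f) x (s *: delta_mx 0 a + h *: delta_mx 0 b) =
      'd (pd a f) x (s *: delta_mx 0 a) + h * pd b (pd a f) x.
    by rewrite linearD [X in _ + X]linearZ /= (pdE b da).
  rewrite /dphi; ring.
rewrite normrM gtr0_norm // expr2 mulrCA ler_pM2l //.
rewrite (le_trans (ler_normB _ _)) //.
rewrite (le_trans (lerD H1 H2)) //.
rewrite -mulrDr mulrAC ler_pdivrMr // mulrAC -mulrA ler_pM2l //.
have n1 := nle s h sh h00.
have n2 : `|s *: (delta_mx 0 a : 'rV[R]_n)| <= h.
  rewrite normrZ (ger0_norm (ltW s0)); apply: le_trans (ltW slth).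
  by rewrite -[leRHS]mulr1; apply: ler_wpM2l; [exact: ltW|exact: norm_delta_mx_le1].
by rewrite (le_trans (lerD n1 n2)) //; lra.
Unshelve. all: by end_near. Qed.

(** Both mixed derivatives are the limit of the same second difference, which
    is symmetric in the two directions. *)
Lemma pd_comm f a b x :
  (\forall y \near x, differentiable f y) ->
  differentiable (pd a f) x -> differentiable (pd b f) x ->
  pd a (pd b f) x = pd b (pd a f) x.
Proof.
move=> df da db; apply/eqP; rewrite -subr_eq0 -normr_eq0; apply/eqP.
apply/le_anti; rewrite normr_ge0 andbT; apply/ler_addgt0Pl => e e0.
rewrite addr0; have e2 : 0 < e / 2 by rewrite divr_gt0.
have [h [h0 [H1 H2]]] := filter_ex (filterI (@nbhs_right_gt R 0)
  (filterI (second_difference_approx b df da e2)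
           (second_difference_approx a df db e2))).
have S : second_difference f b a x h = second_difference f a b x h.
  by rewrite /second_difference [_ *: delta_mx 0 b + (_ + _)]addrCA; ring.
rewrite S in H2.
have h2 : 0 < h ^+ 2 by rewrite exprn_gt0.
move: (pd a (pd b f) x) (pd b (pd a f) x) (second_difference _ _ _ _ _) H1 H2.
move=> p q D H1 H2; rewrite -(ler_pM2r h2) -[h ^+ 2 in leLHS]gtr0_norm // -normrM.
have -> : (p - q) * h ^+ 2 = (D - h ^+ 2 * q) - (D - h ^+ 2 * p) by ring.
rewrite (le_trans (ler_normB _ _)) // (le_trans (lerD H1 H2)) //.
by rewrite -mulrDl -splitr.
Qed.

End Schwarz.

(** * Calculus of matrix valued functions *)

HB.lock Definition mpd (R : realType) n p q (a : 'I_n)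
    (M : 'rV[R]_n -> 'M[R]_(p, q)) (x : 'rV[R]_n) : 'M[R]_(p, q) :=
  \matrix_(i, j) pd a (fun y => M y i j) x.

Lemma mpdE (R : realType) n p q (a : 'I_n) (M : 'rV[R]_n -> 'M[R]_(p, q)) x i j :
  mpd a M x i j = pd a (fun y => M y i j) x.
Proof. by rewrite mpd.unlock mxE. Qed.

Section MatrixCalculus.
Context {R : realType} {n : nat}.
Implicit Types (x : 'rV[R]_n) (a b c : 'I_n).

Definition mdiff p q (M : 'rV[R]_n -> 'M[R]_(p, q)) x : Prop :=
  forall i j, differentiable (fun y => M y i j) x.

Lemma differentiable_fun_eq (f g : 'rV[R]_n -> R) x :
  f =1 g -> differentiable g x -> differentiable f x.
Proof. by move=> /funext ->. Qed.

Lemma open_eq_mpd p q (U : set 'rV[R]_n) (M N : 'rV[R]_n -> 'M[R]_(p, q)) a x :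
  open U -> U x -> (forall y, U y -> M y = N y) -> mpd a M x = mpd a N x.
Proof.
move=> oU Ux MN; apply/matrixP => i j; rewrite !mpdE.
by apply: (open_eq_pd a oU Ux) => y Uy; rewrite MN.
Qed.

Lemma mpdD p q (M N : 'rV[R]_n -> 'M[R]_(p, q)) a x :
  mdiff M x -> mdiff N x ->
  mpd a (fun y => M y + N y) x = mpd a M x + mpd a N x.
Proof.
move=> dM dN; apply/matrixP => i j; rewrite mxE !mpdE -pdD //.
by apply: eq_pd => y; rewrite !mxE.
Qed.

Lemma mdiffM p q r (M : 'rV[R]_n -> 'M[R]_(p, q))
    (N : 'rV[R]_n -> 'M[R]_(q, r)) x :
  mdiff M x -> mdiff N x -> mdiff (fun y => M y *m N y) x.
Proof.
move=> dM dN i j.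
apply: (@differentiable_fun_eq _ (fun y => \sum_k M y i k * N y k j)).
  by move=> y; rewrite !mxE.
by apply: differentiable_sumf => k _; apply: differentiableM.
Qed.

Lemma mpdM p q r (M : 'rV[R]_n -> 'M[R]_(p, q))
    (N : 'rV[R]_n -> 'M[R]_(q, r)) a x :
  mdiff M x -> mdiff N x ->
  mpd a (fun y => M y *m N y) x = mpd a M x *m N x + M x *m mpd a N x.
Proof.
move=> dM dN; apply/matrixP => i j; rewrite mpdE !mxE.
rewrite (_ : (fun y => _) = fun y => \sum_k M y i k * N y k j); last first.
  by apply/funext => y; rewrite !mxE.
rewrite pd_sum -?big_split /=; last by move=> k _; apply: differentiableM.
by apply: eq_bigr => k _; rewrite pdM // !mpdE.
Qed.

Lemma mdiff_tr p q (M : 'rV[R]_n -> 'M[R]_(p, q)) x :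
  mdiff M x -> mdiff (fun y => (M y)^T) x.
Proof.
by move=> dM i j; apply: differentiable_fun_eq (dM j i) => y; rewrite mxE.
Qed.

Lemma mpd_tr p q (M : 'rV[R]_n -> 'M[R]_(p, q)) a x :
  mpd a (fun y => (M y)^T) x = (mpd a M x)^T.
Proof.
apply/matrixP => i j; rewrite mpdE mxE mpdE.
by apply: eq_pd => y; rewrite mxE.
Qed.

Lemma mdiff_sumZ p q (I : finType) (f : I -> 'rV[R]_n -> R)
    (M : I -> 'rV[R]_n -> 'M[R]_(p, q)) x :
  (forall i, differentiable (f i) x) -> (forall i, mdiff (M i) x) ->
  mdiff (fun y => \sum_i f i y *: M i y) x.
Proof.
move=> df dM i j.
apply: (@differentiable_fun_eq _ (fun y => \sum_k f k y * M k y i j)).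
  by move=> y; rewrite summxE; apply: eq_bigr => k _; rewrite mxE.
by apply: differentiable_sumf => k _; apply: differentiableM => //; exact: dM.
Qed.

Lemma mpd_sumZ p q (I : finType) (f : I -> 'rV[R]_n -> R)
    (M : I -> 'rV[R]_n -> 'M[R]_(p, q)) a x :
  (forall i, differentiable (f i) x) -> (forall i, mdiff (M i) x) ->
  mpd a (fun y => \sum_i f i y *: M i y) x =
  \sum_i (pd a (f i) x *: M i x + f i x *: mpd a (M i) x).
Proof.
move=> df dM; apply/matrixP => i j; rewrite mpdE summxE.
rewrite (_ : (fun y => _) = fun y => \sum_k f k y * M k y i j); last first.
  by apply/funext => y; rewrite summxE; apply: eq_bigr => k _; rewrite mxE.
rewrite pd_sum; last by move=> k _; apply: differentiableM => //; exact: dM.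
by apply: eq_bigr => k _; rewrite pdM ?mxE ?mpdE //; exact: dM.
Qed.

Lemma differentiable_det p (M : 'rV[R]_n -> 'M[R]_p) x :
  mdiff M x -> differentiable (fun y => \det (M y)) x.
Proof.
move=> dM; apply: differentiable_sumf => s _.
apply: differentiableM; first exact: differentiable_cst.
by apply: differentiable_prodf => i _; exact: dM.
Qed.

Lemma mdiff_inv p (M : 'rV[R]_n -> 'M[R]_p) x :
  (\forall y \near x, M y \in unitmx) -> mdiff M x ->
  mdiff (fun y => invmx (M y)) x.
Proof.
move=> uM dM i j; have ux := nbhs_singleton uM.
apply: (@near_eq_differentiable _ _ _
  (fun y => (\det (M y))^-1 * cofactor (M y) j i)).
  by apply: filterS uM => y uy; rewrite /invmx uy !mxE.
apply: differentiableM.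
  apply: differentiableV; first exact: differentiable_det.
  by move: ux; rewrite unitmxE unitfE.
apply: differentiableM; first exact: differentiable_cst.
apply: differentiable_det => k l.
by apply: differentiable_fun_eq (dM (lift j k) (lift i l)) => y; rewrite !mxE.
Qed.

End MatrixCalculus.

(** * The Levi-Civita connection and its curvature *)

Section Christoffel.
Context {R : realType} {n : nat}.
Implicit Types (x : 'rV[R]_n) (a b c k : 'I_n) (U : set 'rV[R]_n)
  (g : 'rV[R]_n -> 'M[R]_n).

(** A pseudo-Riemannian metric on a coordinate domain. *)
Definition coord_metric U g : Prop :=
  [/\ open U, forall x, U x -> (g x)^T = g x, forall x, U x -> g x \in unitmx &
      forall a b, smooth_on U (fun x => g x a b)].

(** The Levi-Civita connection form: row b, column k holds the symbol with
    upper index k and lower indices c, b, so that the covariant derivative of a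
    row vector v in the direction c is d_c v + v gam g c. *)
Definition gam g c x : 'M[R]_n := \matrix_(b, k) christoffel g k c b x.

(** Christoffel symbols of the first kind. *)
Definition low_gam g c x : 'M[R]_n :=
  \matrix_(b, l) (2^-1 * (mpd c g x b l + mpd b g x c l - mpd l g x c b)).

Lemma low_gamE g c x b l : low_gam g c x b l =
  2^-1 * (mpd c g x b l + mpd b g x c l - mpd l g x c b).
Proof. by rewrite mxE. Qed.

Lemma add_trE (A : 'M[R]_n) i j : (A + A^T) i j = A i j + A j i.
Proof. by rewrite !mxE. Qed.

Definition ricm g x : 'M[R]_n := \matrix_(a, b) ricci g a b x.

Lemma gamE g c x : gam g c x = low_gam g c x *m (invmx (g x))^T.
Proof.
apply/matrixP => b k; rewrite !mxE /christoffel mulr_sumr.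
apply: eq_bigr => l _; rewrite !mxE !mpdE. by rewrite [invmx _ _ _ * _]mulrC mulrA.
Qed.

Lemma smooth_on_mdiff U g x : (forall a b, smooth_on U (fun x => g x a b)) ->
  U x -> mdiff g x.
Proof. by move=> sg Ux a b; exact: (sg a b [::]). Qed.

Lemma smooth_on_mdiff_mpd U g c x :
  (forall a b, smooth_on U (fun x => g x a b)) -> U x -> mdiff (mpd c g) x.
Proof.
move=> sg Ux a b; apply: differentiable_fun_eq (sg a b [:: c] x Ux) => y.
by rewrite mpdE.
Qed.

Lemma open_near U x : open U -> U x -> \forall y \near x, U y.
Proof. by move=> oU Ux; exact: open_nbhs_nbhs. Qed.

Lemma mdiff_gam U g c x : coord_metric U g -> U x -> mdiff (gam g c) x.
Proof.
move=> [oU _ ug sg] Ux.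
rewrite (_ : gam g c = fun y => low_gam g c y *m (invmx (g y))^T); last first.
  by apply/funext => y; exact: gamE.
apply: mdiffM; last first.
  apply/mdiff_tr/mdiff_inv; last exact: smooth_on_mdiff Ux.
  exact: filterS (open_near oU Ux).
move=> b l; apply: (@differentiable_fun_eq _ _ _ (fun y =>
  2^-1 * (mpd c g y b l + mpd b g y c l - mpd l g y c b))).
  by move=> y; rewrite mxE.
have D d := smooth_on_mdiff_mpd d sg Ux.
apply: differentiableM; first exact: differentiable_cst.
apply: differentiableB; last exact: D.
by apply: differentiableD; exact: D.
Qed.

Lemma mpd_sym U g c x : coord_metric U g -> U x -> (mpd c g x)^T = mpd c g x.
Proof.
move=> [oU sg _ _] Ux; rewrite -mpd_tr.
by apply: (open_eq_mpd c oU Ux) => y Uy; exact: sg.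
Qed.

Lemma gam_sym U g b c x : coord_metric U g -> U x ->
  row b (gam g c x) = row c (gam g b x).
Proof.
move=> mg Ux; apply/rowP => k; rewrite !gamE !mxE.
apply: eq_bigr => l _; congr (_ * _); rewrite !mxE.
rewrite [mpd c _ _ _ _ + _]addrC; congr (_ * (_ - _)).
by have /matrixP/(_ b c) := mpd_sym l mg Ux; rewrite !mxE.
Qed.

Lemma gam_low U g c x : coord_metric U g -> U x ->
  gam g c x *m g x = low_gam g c x.
Proof.
move=> [_ sg ug _] Ux; rewrite gamE trmx_inv sg //.
by rewrite -mulmxA mulVmx ?mulmx1 ?ug.
Qed.

(** Metric compatibility: in the sum of the two lowered symbols, the terms of
    the Koszul formula other than the derivative of g along c cancel. *)
Lemma gam_compat U g c x : coord_metric U g -> U x ->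
  mpd c g x = gam g c x *m g x + (gam g c x *m g x)^T.
Proof.
move=> mg Ux; rewrite (gam_low _ mg Ux); apply/matrixP => b l.
have S d i j : mpd d g x i j = mpd d g x j i.
  by have /matrixP/(_ j i) := mpd_sym d mg Ux; rewrite mxE.
rewrite add_trE !low_gamE.
rewrite (S c l b) (S l c b) (S b c l) (S l b c) (S b l c).
move: (mpd c g x b l) (mpd b g x c l) (mpd l g x c b) => p q r.
by field.
Qed.

(** By symmetry, the three cyclic permutations of the compatibility equation
    combine into the Koszul formula. All Levi-Civita connections below are
    identified in this way, which avoids the inverse of the metric. *)
Lemma gam_unique U g (B : 'I_n -> 'M[R]_n) x : coord_metric U g -> U x ->
  (forall b c, row b (B c) = row c (B b)) ->
  (forall c, mpd c g x = B c *m g x + (B c *m g x)^T) ->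
  forall c, gam g c x = B c.
Proof.
move=> mg Ux sB cB c; have [_ sg ug _] := mg.
have u := ug _ Ux.
apply: (can_inj (mulmxK u)); rewrite (gam_low _ mg Ux).
pose T c := B c *m g x; rewrite -/(T c).
have sT i j l : T i j l = T j i l.
  rewrite /T; have := congr1 (fun v => (v *m g x) 0 l) (sB j i).
  by rewrite /= -!row_mul !mxE.
apply/matrixP => b l.
rewrite low_gamE !cB -!/(T _) !add_trE (sT b c l) (sT l c b) (sT l b c).
by move: (T c b l) (T c l b) (T b l c) => p q r; field.
Qed.

(** The commutator of the covariant derivatives along k and b, acting on row
    vectors from the right. *)
Definition curv (A : 'I_n -> 'rV[R]_n -> 'M[R]_n) k b x : 'M[R]_n :=
  mpd k (A b) x - mpd b (A k) x + (A b x *m A k x - A k x *m A b x).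

Lemma ricciE U g a b x : coord_metric U g -> U x ->
  ricci g a b x = \sum_k curv (gam g) k b x a k.
Proof.
move=> mg Ux; have [oU _ _ _] := mg.
have S k i j y : U y -> christoffel g k i j y = christoffel g k j i y.
  move=> Uy; have /rowP/(_ k) := gam_sym j i mg Uy.
  by rewrite !mxE.
rewrite /ricci -big_split /=; apply: eq_bigr => k _.
rewrite [in RHS]mxE; congr (_ + _).
  rewrite !mxE !mpdE; congr (_ - _); apply: (open_eq_pd _ oU Ux) => y Uy; rewrite !mxE.
    exact: S.
  exact: S.
rewrite !mxE -sumrB; apply: eq_bigr => l _; rewrite !mxE.
by rewrite (S l a b x Ux) (S l a k x Ux) mulrC [X in _ - X]mulrC.
Qed.

End Christoffel.

(** * Naturality of the Ricci tensor *)

Section Smooth.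
Context {R : realType} {n : nat}.
Implicit Types (x : 'rV[R]_n) (a b c k : 'I_n) (U : set 'rV[R]_n).

Lemma smooth_on_pd (V : normedModType R) U (f : 'rV[R]_n -> V) a :
  smooth_on U f -> smooth_on U (pd a f).
Proof.
move=> sf s x Ux; have := sf (rcons s a) x Ux.
by rewrite foldr_rcons.
Qed.

Lemma smooth_on_coord U m (F : 'rV[R]_n -> 'rV[R]_m) (c : 'I_m) :
  open U -> smooth_on U F -> smooth_on U (fun y => F y 0 c).
Proof.
move=> oU sF.
have E s x : U x -> foldr (fun a h => pd a h) (fun y => F y 0 c) s x =
    (foldr (fun a h => pd a h) F s x) 0 c.
  elim: s x => [//|a s IH] x Ux /=.
  rewrite (open_eq_pd a oU Ux IH) [in RHS]/pd derive_mx ?mxE //.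
  by apply: diff_derivable; exact: sF.
move=> s x Ux; apply: (@near_eq_differentiable _ _ _
   (fun y => (foldr (fun a h => pd a h) F s y) 0 c)).
  by apply: filterS (open_near oU Ux) => y Uy; rewrite E.
apply: (@differentiable_comp _ _ _ _ _ (fun z : 'rV_m => z 0 c)); first exact: sF.
exact: differentiable_coord.
Qed.

Lemma smooth_pd_comm U (f : 'rV[R]_n -> R) a b x :
  open U -> smooth_on U f -> U x -> pd a (pd b f) x = pd b (pd a f) x.
Proof.
move=> oU sf Ux; apply: pd_comm; last 2 first.
- exact: (sf [:: a]).
- exact: (sf [:: b]).
by apply: filterS (open_near oU Ux) => y Uy; exact: (sf [::]).
Qed.

End Smooth.

Section Naturality.
Context {R : realType} {n : nat}.
Variables (U W : set 'rV[R]_n) (g h : 'rV[R]_n -> 'M[R]_n)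
  (F : 'rV[R]_n -> 'rV[R]_n).
Hypotheses (mg : coord_metric U g) (mh : coord_metric W h)
  (sF : smooth_on U F) (UW : forall x, U x -> W (F x))
  (gE : forall x, U x -> g x = jac F x *m h (F x) *m (jac F x)^T).
Implicit Types (x : 'rV[R]_n) (a b c k : 'I_n).

Let J := jac F.

Let oU : open U. Proof. by case: mg. Qed.

Let dF x : U x -> differentiable F x. Proof. exact: (sF [::]). Qed.

Let sFc c : smooth_on U (fun y => F y 0 c).
Proof. exact: smooth_on_coord. Qed.

Lemma jac_unit x : U x -> J x \in unitmx.
Proof.
move=> Ux; have [_ _ /(_ x Ux) + _] := mg.
by rewrite gE // -mulmxA unitmx_mul => /andP[].
Qed.

Let dJ x : U x -> mdiff J x.
Proof.
move=> Ux a c; apply: differentiable_fun_eq (sFc c [:: a] Ux) => y.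
by rewrite /J jacE.
Qed.

Let mpdJE c a i x : mpd c J x a i = pd c (pd a (fun y => F y 0 i)) x.
Proof.
by rewrite mpdE; apply: eq_pd => y; rewrite /J jacE.
Qed.

Let mpdJ_sym a b i x : U x -> mpd a J x b i = mpd b J x a i.
Proof. by move=> Ux; rewrite !mpdJE; exact: (smooth_pd_comm a b oU (sFc i) Ux). Qed.

Let dmpdJ a x : U x -> mdiff (mpd a J) x.
Proof.
move=> Ux b i; apply: differentiable_fun_eq (sFc i [:: a; b] Ux) => y.
by rewrite mpdJE.
Qed.

Let mpdJ_comm a b x : U x -> mpd a (mpd b J) x = mpd b (mpd a J) x.
Proof.
move=> Ux; apply/matrixP => i j; rewrite !(mpdE _ (mpd _ _)).
have E c : (fun y => mpd c J y i j) = pd c (pd i (fun z => F z 0 j)).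
  by apply/funext => y; rewrite mpdJE.
by rewrite !E; exact: (smooth_pd_comm a b oU (smooth_on_pd i (sFc j)) Ux).
Qed.

Lemma mpd_pull p q (M : 'rV[R]_n -> 'M[R]_(p, q)) a x : U x -> mdiff M (F x) ->
  mpd a (fun y => M (F y)) x = \sum_c J x a c *: mpd c M (F x).
Proof.
move=> Ux dM; apply/matrixP => i j; rewrite mpdE summxE.
rewrite (pd_comp (h := fun z => M z i j)) //; last exact: dF.
by apply: eq_bigr => c _; rewrite mxE mpdE /J jacE.
Qed.

Lemma mdiff_pull p q (M : 'rV[R]_n -> 'M[R]_(p, q)) x : U x -> mdiff M (F x) ->
  mdiff (fun y => M (F y)) x.
Proof.
move=> Ux dM i j.
by apply: (differentiable_comp (g := fun z => M z i j)); [exact: dF|exact: dM].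
Qed.

(** The connection forms of h pulled back along F. *)
Let At c x : 'M[R]_n := \sum_i J x c i *: gam h i (F x).

Let dh x : U x -> mdiff h (F x).
Proof. by move=> Ux; have [_ _ _ sh] := mh; apply: smooth_on_mdiff sh (UW Ux). Qed.

(** The gauge transform of the connection of h by J is symmetric, because the
    second derivatives of F commute, and it is compatible with the pulled back
    metric; so it is the connection of g. *)
Lemma gam_gauge c x : U x -> gam g c x *m J x = mpd c J x + J x *m At c x.
Proof.
move=> Ux; have uJ := jac_unit Ux.
pose B c := (mpd c J x + J x *m At c x) *m invmx (J x).
suff -> : gam g c x = B c by rewrite /B mulmxKV.
have BJ d : B d *m J x = mpd d J x + J x *m At d x by rewrite /B mulmxKV.
apply: (gam_unique mg Ux) => [b d|d].
  apply: (can_inj (mulmxK uJ)); rewrite -!row_mul !BJ.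
  have E i j k : (J x *m At i x) j k =
      \sum_a \sum_l J x j a * J x i l * gam h l (F x) a k.
    rewrite mxE; apply: eq_bigr => a _; rewrite /At summxE mulr_sumr.
    by apply: eq_bigr => l _; rewrite mxE mulrA.
  apply/rowP => k; rewrite !linearD /=.
  rewrite [LHS]mxE [RHS]mxE [row _ (mpd _ _ _) _ _]mxE.
  rewrite [X in _ = X + _]mxE (mpdJ_sym d b k Ux); congr (_ + _).
  rewrite [LHS]mxE [RHS]mxE !E exchange_big; apply: eq_bigr => i _.
  apply: eq_bigr => j _; congr (_ * _); first by rewrite mulrC.
  by have /rowP/(_ k) := gam_sym i j mh (UW Ux); rewrite !mxE.
have hE : mpd d (fun y => h (F y)) x =
    At d x *m h (F x) + (At d x *m h (F x))^T.
  rewrite (mpd_pull d Ux (dh Ux)) /At mulmx_suml linear_sum -big_split /=.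
  apply: eq_bigr => i _; rewrite -scalemxAl linearZ -scalerDr /=.
  by rewrite -(gam_compat i mh (UW Ux)).
have [_ sh _ _] := mh.
rewrite (open_eq_mpd d oU Ux gE).
have dJx := dJ Ux; have dhF := mdiff_pull Ux (dh Ux).
rewrite (mpdM _ (mdiffM dJx dhF) (mdiff_tr dJx)) (mpdM _ dJx dhF) mpd_tr hE.
rewrite gE // -!/(J _).
have -> : B d *m (J x *m h (F x) *m (J x)^T) =
   mpd d J x *m h (F x) *m (J x)^T + J x *m (At d x *m h (F x)) *m (J x)^T.
  by rewrite 2!mulmxA BJ !mulmxDl !mulmxA.
rewrite !(linearD, mulmxDl, mulmxDr) /= !trmx_mul !trmxK (sh _ (UW Ux)).
by rewrite !mulmxA -!addrA; congr (_ + (_ + _)); exact: addrC.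
Qed.

Let dAt c x : U x -> mdiff (At c) x.
Proof.
move=> Ux; apply: mdiff_sumZ => i; first exact: dJ.
by apply: (mdiff_pull Ux); apply: mdiff_gam mh (UW Ux).
Qed.

Let curvt k b x := mpd k (At b) x - mpd b (At k) x
  + (At b x *m At k x - At k x *m At b x).

(** The gauge relation is differentiated once more. The second derivatives of J
    cancel by antisymmetry, and the gauge relation itself eliminates the first
    ones. *)
Lemma curv_gauge k b x : U x ->
  curv (gam g) k b x *m J x = J x *m curvt k b x.
Proof.
move=> Ux.
have dg c : mdiff (gam g c) x by exact: mdiff_gam mg Ux.
have dJx := dJ Ux.
have dJAt c : mdiff (fun y => J y *m At c y) x by apply: mdiffM => //; exact: dAt.
have E c d : mpd c (gam g d) x *m J x + gam g d x *m mpd c J x =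
    mpd c (mpd d J) x + (mpd c J x *m At d x + J x *m mpd c (At d) x).
  rewrite -(mpdM _ (dg d) dJx) (open_eq_mpd c oU Ux (gam_gauge d)).
  by rewrite (mpdD _ (dmpdJ d Ux) (dJAt d)) (mpdM _ dJx (dAt d Ux)).
have JE c : mpd c J x = gam g c x *m J x - J x *m At c x.
  by rewrite (gam_gauge c Ux) addrK.
have E1 := E k b; have E2 := E b k.
rewrite (mpdJ_comm b k Ux) in E2.
rewrite /curv /curvt !(mulmxDl, mulmxDr, mulNmx, mulmxN).
have -> : mpd k (gam g b) x *m J x = mpd k (mpd b J) x
   + (mpd k J x *m At b x + J x *m mpd k (At b) x) - gam g b x *m mpd k J x.
  by rewrite -E1 addrK.
have -> : mpd b (gam g k) x *m J x = mpd k (mpd b J) x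
   + (mpd b J x *m At k x + J x *m mpd b (At k) x) - gam g k x *m mpd b J x.
  by rewrite -E2 addrK.
rewrite (JE k) (JE b) !(mulmxDl, mulmxDr, mulNmx, mulmxN, mulmxA).
move: (mpd k (mpd b J) x) (J x *m mpd k _ x) (J x *m mpd b _ x)
  (gam g k x *m J x *m At b x) (gam g b x *m J x *m At k x)
  (J x *m At k x *m At b x) (J x *m At b x *m At k x)
  (gam g b x *m gam g k x *m J x) (gam g k x *m gam g b x *m J x).
move=> p q r s t u v w z.
apply/matrixP => i j; rewrite !mxE.
by move: (p i j) (q i j) (r i j) (s i j) (t i j) (u i j) (v i j) (w i j) (z i j)
  => {p q r s t u v w z} *; ring.
Qed.

(** Curvature commutes with the pullback of forms: derivatives of the factors J
    are symmetric in the two directions, hence drop out. *)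
Lemma curvtE k b x : U x ->
  curvt k b x = \sum_i \sum_j (J x b i * J x k j) *: curv (gam h) j i (F x).
Proof.
move=> Ux; have WF := UW Ux.
have dG i : mdiff (gam h i) (F x) by exact: mdiff_gam mh WF.
have E c d : mpd c (At d) x = \sum_i mpd c J x d i *: gam h i (F x) +
    \sum_i \sum_j (J x d i * J x c j) *: mpd j (gam h i) (F x).
  rewrite mpd_sumZ; last 2 first.
  - by move=> i; exact: dJ.
  - by move=> i; exact: (mdiff_pull Ux (dG i)).
  rewrite big_split /=; congr (_ + _); apply: eq_bigr => i _; first by rewrite mpdE.
  rewrite (mpd_pull _ Ux (dG i)) scaler_sumr.
  by apply: eq_bigr => j _; rewrite scalerA.
have P c d : At c x *m At d x = \sum_i \sum_j (J x c i * J x d j) *: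
    (gam h i (F x) *m gam h j (F x)).
  rewrite /At mulmx_suml; apply: eq_bigr => i _; rewrite mulmx_sumr.
  by apply: eq_bigr => j _; rewrite -scalemxAl -scalemxAr scalerA.
rewrite /curvt !E !P.
have -> : \sum_i mpd b J x k i *: gam h i (F x) =
          \sum_i mpd k J x b i *: gam h i (F x).
  by apply: eq_bigr => i _; rewrite mpdJ_sym.
rewrite [X in _ - (_ + X)]exchange_big [X in _ + (_ - X)]exchange_big /=.
rewrite [X in X - _ + _]addrC addrKA -!sumrB -big_split /=.
apply: eq_bigr => i _; rewrite -!sumrB -big_split /=.
apply: eq_bigr => j _; rewrite [J x k j * _]mulrC.
by rewrite -!scalerBr -scalerDr.
Qed.

(** Taking the trace removes the conjugation by J of the curvature and leaves
    one factor J for each of the two indices. *)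
Theorem ricci_pullback x : U x -> ricm g x = J x *m ricm h (F x) *m (J x)^T.
Proof.
move=> Ux; have uJ := jac_unit Ux; have WF := UW Ux.
have curvE k b : curv (gam g) k b x = \sum_i \sum_j (J x b i * J x k j) *:
   (J x *m curv (gam h) j i (F x) *m invmx (J x)).
  rewrite -[LHS](mulmxK uJ) (curv_gauge _ _ Ux) (curvtE _ _ Ux).
  rewrite mulmx_sumr mulmx_suml; apply: eq_bigr => i _.
  rewrite mulmx_sumr mulmx_suml; apply: eq_bigr => j _.
  by rewrite -scalemxAr -scalemxAl.
apply/matrixP => a b; rewrite mxE (ricciE a b mg Ux).
transitivity (\sum_i J x b i * \sum_j \sum_k
    (J x *m curv (gam h) j i (F x) *m invmx (J x)) a k * J x k j).
  under eq_bigr do rewrite curvE summxE.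
  rewrite exchange_big; apply: eq_bigr => i _; rewrite mulr_sumr.
  under eq_bigr do rewrite summxE.
  rewrite exchange_big; apply: eq_bigr => j _; rewrite mulr_sumr.
  by apply: eq_bigr => k _; rewrite !mxE -!mulrA [X in _ = _ * X]mulrC.
rewrite mxE; apply: eq_bigr => i _; rewrite mulrC [_^T _ _]mxE; congr (_ * _).
transitivity (\sum_j (J x *m curv (gam h) j i (F x)) a j).
  by apply: eq_bigr => j _; rewrite -[in RHS](mulmxKV uJ (J x *m _)) [RHS]mxE.
rewrite mxE.
under eq_bigr do rewrite mxE.
rewrite exchange_big; apply: eq_bigr => l _; rewrite -mulr_sumr; congr (_ * _).
by rewrite mxE (ricciE _ _ mh WF).
Qed.

End Naturality.

(** * Riemannian products *)

Section LinearPullback.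
Context {R : realType} {n m : nat}.
Variables (L : {linear 'rV[R]_n -> 'rV[R]_m}).

Lemma derive_linear_pull (V : normedModType R) (f : 'rV[R]_m -> V)
    (v x : 'rV[R]_n) : 'D_v (f \o L) x = 'D_(L v) f (L x).
Proof.
rewrite /derive.
have -> : (fun h : R => h^-1 *: (((f \o L) \o shift x) (h *: v) - (f \o L) x)) =
    (fun h : R => h^-1 *: ((f \o shift (L x)) (h *: L v) - f (L x))).
  by apply/funext => h /=; rewrite linearP.
by [].
Qed.

(** Each iterated partial derivative of the composition is either zero or the
    composition of L with an iterated partial derivative of f. *)
Lemma smooth_on_linear_pull (V : normedModType R) (U : set 'rV[R]_m)
    (f : 'rV[R]_m -> V) :
  continuous L ->
  (forall a, L (delta_mx 0 a) = 0 \/ exists b, L (delta_mx 0 a) = delta_mx 0 b) ->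
  smooth_on U f -> smooth_on (L @^-1` U) (f \o L).
Proof.
move=> cL La sf s x Ux.
have [->|[t ->]] : foldr (fun a h => pd a h) (f \o L) s = (fun=> 0) \/
    exists t, foldr (fun a h => pd a h) (f \o L) s =
              foldr (fun a h => pd a h) f t \o L.
- elim: s => [|a s IH] /=; first by right; exists [::].
  case: IH => [->|[t ->]].
    by left; apply/funext => y; rewrite pd_cst.
  case: (La a) => [L0|[b Lb]].
    by left; apply/funext => y; rewrite /pd derive_linear_pull L0 derive0.
  right; exists (b :: t); apply/funext => y.
  by rewrite /pd derive_linear_pull Lb.
- exact: differentiable_cst.
- apply: differentiable_comp; last exact: sf.
  exact: linear_differentiable.
Qed.

End LinearPullback.

Section ProductMetric.
Context {R : realType} {n k : nat}.
Variables (U : set 'rV[R]_n) (W : set 'rV[R]_k)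
  (g : 'rV[R]_n -> 'M[R]_n) (h : 'rV[R]_k -> 'M[R]_k).
Hypotheses (mg : coord_metric U g) (mh : coord_metric W h).

Let pg (v : 'rV[R]_(n + k)) : 'M[R]_(n + k) :=
  block_mx (g (lsubmx v)) 0 0 (h (rsubmx v)).

Let UW := [set v : 'rV[R]_(n + k) | U (lsubmx v) /\ W (rsubmx v)].

Lemma lsubmx_delta (a : 'I_n) :
  lsubmx (delta_mx 0 (lshift k a) : 'rV[R]_(n + k)) = delta_mx 0 a.
Proof. by apply/rowP => i; rewrite !mxE (inj_eq (@lshift_inj _ _)). Qed.

Lemma lsubmx_delta0 (b : 'I_k) :
  lsubmx (delta_mx 0 (rshift n b) : 'rV[R]_(n + k)) = 0.
Proof. by apply/rowP => i; rewrite !mxE eq_lrshift. Qed.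

Lemma rsubmx_delta (b : 'I_k) :
  rsubmx (delta_mx 0 (rshift n b) : 'rV[R]_(n + k)) = delta_mx 0 b.
Proof. by apply/rowP => i; rewrite !mxE (inj_eq (@rshift_inj _ _)). Qed.

Lemma rsubmx_delta0 (a : 'I_n) :
  rsubmx (delta_mx 0 (lshift k a) : 'rV[R]_(n + k)) = 0.
Proof. by apply/rowP => i; rewrite !mxE eq_rlshift. Qed.

Lemma continuous_lsubmx : continuous (@lsubmx R 1 n k).
Proof.
by move=> x; apply: differentiable_continuous; exact: differentiable_lsubmx.
Qed.

Lemma continuous_rsubmx : continuous (@rsubmx R 1 n k).
Proof.
by move=> x; apply: differentiable_continuous; exact: differentiable_rsubmx.
Qed.

Lemma smooth_on_lsubmx (f : 'rV[R]_n -> R) :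
  smooth_on U f -> smooth_on UW (fun v => f (lsubmx v)).
Proof.
move=> sf s v [Uv _].
apply: (smooth_on_linear_pull (L := @lsubmx R 1 n k)) Uv => //.
  exact: continuous_lsubmx.
move=> a; case: (split_ordP a) => i ->.
  by right; exists i; exact: lsubmx_delta.
by left; exact: lsubmx_delta0.
Qed.

Lemma smooth_on_rsubmx (f : 'rV[R]_k -> R) :
  smooth_on W f -> smooth_on UW (fun v => f (rsubmx v)).
Proof.
move=> sf s v [_ Wv].
apply: (smooth_on_linear_pull (L := @rsubmx R 1 n k)) Wv => //.
  exact: continuous_rsubmx.
move=> a; case: (split_ordP a) => i ->.
  by left; exact: rsubmx_delta0.
by right; exists i; exact: rsubmx_delta.
Qed.

Lemma smooth_on_cst m (V : normedModType R) (S : set 'rV[R]_m) (c : V) :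
  smooth_on S (fun=> c).
Proof.
move=> s x _; have [d ->] : exists d : V,
    foldr (fun a h => pd a h) (fun=> c) s = fun=> d.
  elim: s => [|a s [d IH]] /=; first by exists c.
  by exists 0; rewrite IH; apply/funext => y; rewrite pd_cst.
exact: differentiable_cst.
Qed.

Lemma coord_metric_prod : coord_metric UW pg.
Proof.
have [oU sg ug smg] := mg; have [oW sh uh smh] := mh.
split.
- have -> : UW = (@lsubmx R 1 n k @^-1` U) `&` (@rsubmx R 1 n k @^-1` W) by [].
  apply: openI; apply: open_comp => // x _.
    exact: continuous_lsubmx.
  exact: continuous_rsubmx.
- by move=> v [Uv Wv]; rewrite /pg tr_block_mx sg // sh // !trmx0.
- move=> v [Uv Wv]; rewrite unitmxE /pg det_ublock unitrM -!unitmxE.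
  by rewrite ug ?uh.
- move=> a b; case: (split_ordP a) => i ->; case: (split_ordP b) => j ->.
  + have -> : (fun v => pg v (lshift k i) (lshift k j)) = fun v => g (lsubmx v) i j.
      by apply/funext => v; rewrite /pg block_mxEul.
    exact: (smooth_on_lsubmx (smg i j)).
  + have -> : (fun v => pg v (lshift k i) (rshift n j)) = fun=> 0.
      by apply/funext => v; rewrite /pg block_mxEur mxE.
    exact: smooth_on_cst.
  + have -> : (fun v => pg v (rshift n i) (lshift k j)) = fun=> 0.
      by apply/funext => v; rewrite /pg block_mxEdl mxE.
    exact: smooth_on_cst.
  + have -> : (fun v => pg v (rshift n i) (rshift n j)) = fun v => h (rsubmx v) i j.
      by apply/funext => v; rewrite /pg block_mxEdr.
    exact: (smooth_on_rsubmx (smh i j)).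
Qed.

Lemma mpd_block p1 p2 q1 q2 m c (A : 'rV[R]_m -> 'M[R]_(p1, q1))
    (B : 'rV[R]_m -> 'M[R]_(p1, q2)) (C : 'rV[R]_m -> 'M[R]_(p2, q1))
    (D : 'rV[R]_m -> 'M[R]_(p2, q2)) x :
  mpd c (fun y => block_mx (A y) (B y) (C y) (D y)) x =
  block_mx (mpd c A x) (mpd c B x) (mpd c C x) (mpd c D x).
Proof.
apply/matrixP => a b.
case: (split_ordP a) => i ->; case: (split_ordP b) => j ->;
  rewrite ?block_mxEul ?block_mxEur ?block_mxEdl ?block_mxEdr !mpdE;
  by apply: eq_pd => y;
     rewrite ?block_mxEul ?block_mxEur ?block_mxEdl ?block_mxEdr.
Qed.

Lemma mpd_cst p q m c (A : 'M[R]_(p, q)) (x : 'rV[R]_m) : mpd c (fun=> A) x = 0.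
Proof. by apply/matrixP => i j; rewrite mpdE mxE pd_cst. Qed.

Lemma mpd_lsubmx p q (A : 'rV[R]_n -> 'M[R]_(p, q)) a (v : 'rV[R]_(n + k)) :
  mpd (lshift k a) (fun y => A (lsubmx y)) v = mpd a A (lsubmx v).
Proof.
apply/matrixP => i j; rewrite !mpdE /pd.
rewrite (derive_linear_pull (@lsubmx R 1 n k) (fun z => A z i j)).
by rewrite /= lsubmx_delta.
Qed.

Lemma mpd_lsubmx0 p q (A : 'rV[R]_n -> 'M[R]_(p, q)) b (v : 'rV[R]_(n + k)) :
  mpd (rshift n b) (fun y => A (lsubmx y)) v = 0.
Proof.
apply/matrixP => i j; rewrite mpdE mxE /pd.
rewrite (derive_linear_pull (@lsubmx R 1 n k) (fun z => A z i j)).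
by rewrite /= lsubmx_delta0 derive0.
Qed.

Lemma mpd_rsubmx p q (A : 'rV[R]_k -> 'M[R]_(p, q)) b (v : 'rV[R]_(n + k)) :
  mpd (rshift n b) (fun y => A (rsubmx y)) v = mpd b A (rsubmx v).
Proof.
apply/matrixP => i j; rewrite !mpdE /pd.
rewrite (derive_linear_pull (@rsubmx R 1 n k) (fun z => A z i j)).
by rewrite /= rsubmx_delta.
Qed.

Lemma mpd_rsubmx0 p q (A : 'rV[R]_k -> 'M[R]_(p, q)) a (v : 'rV[R]_(n + k)) :
  mpd (lshift k a) (fun y => A (rsubmx y)) v = 0.
Proof.
apply/matrixP => i j; rewrite mpdE mxE /pd.
rewrite (derive_linear_pull (@rsubmx R 1 n k) (fun z => A z i j)).
by rewrite /= rsubmx_delta0 derive0.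
Qed.

Definition gam_prod (c : 'I_(n + k)) (v : 'rV[R]_(n + k)) : 'M[R]_(n + k) :=
  match fintype.split c with
  | inl a => block_mx (gam g a (lsubmx v)) 0 0 0
  | inr b => block_mx 0 0 0 (gam h b (rsubmx v))
  end.

Lemma gam_prodl a v :
  gam_prod (lshift k a) v = block_mx (gam g a (lsubmx v)) 0 0 0.
Proof. by rewrite /gam_prod (unsplitK (inl a)). Qed.

Lemma gam_prodr b v :
  gam_prod (rshift n b) v = block_mx 0 0 0 (gam h b (rsubmx v)).
Proof. by rewrite /gam_prod (unsplitK (inr b)). Qed.

Lemma row_block_l (A : 'M[R]_n) (B : 'M[R]_(n, k))
    (C : 'M[R]_(k, n)) (D : 'M[R]_k) i :
  row (lshift k i) (block_mx A B C D) = row_mx (row i A) (row i B).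
Proof. by rewrite block_mxEv rowKu row_row_mx. Qed.

Lemma row_block_r (A : 'M[R]_n) (B : 'M[R]_(n, k))
    (C : 'M[R]_(k, n)) (D : 'M[R]_k) i :
  row (rshift n i) (block_mx A B C D) = row_mx (row i C) (row i D).
Proof. by rewrite block_mxEv rowKd row_row_mx. Qed.

(** The block diagonal connection is symmetric and compatible with the product
    metric, so it is its Levi-Civita connection. *)
Lemma gam_prodE c v : UW v -> gam pg c v = gam_prod c v.
Proof.
move=> UWv; have [Uv Wv] := UWv; move: c.
apply: (gam_unique coord_metric_prod UWv) => [b c|c].
  case: (split_ordP b) => i ->; case: (split_ordP c) => j ->;
    rewrite ?gam_prodl ?gam_prodr ?row_block_l ?row_block_r ?row0 ?row_mx0 //.
  - by rewrite (gam_sym _ _ mg Uv).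
  - by rewrite (gam_sym _ _ mh Wv).
rewrite /pg mpd_block !mpd_cst; case: (split_ordP c) => i ->.
- rewrite gam_prodl mpd_lsubmx mpd_rsubmx0 (gam_compat i mg Uv).
  by rewrite mulmx_block !(mul0mx, mulmx0, addr0, add0r) tr_block_mx !trmx0
    add_block_mx !addr0.
- rewrite gam_prodr mpd_rsubmx mpd_lsubmx0 (gam_compat i mh Wv).
  by rewrite mulmx_block !(mul0mx, mulmx0, addr0, add0r) tr_block_mx !trmx0
    add_block_mx !addr0.
Qed.

Let curv_gam_prod c d v : UW v -> curv (gam pg) c d v = curv gam_prod c d v.
Proof.
move=> UWv; have [oUW _ _ _] := coord_metric_prod.
rewrite /curv !gam_prodE //.
by rewrite !(fun a b => open_eq_mpd a oUW UWv (fun y => @gam_prodE b y)).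
Qed.

Let mpd_prodll a b v : mpd (lshift k a) (gam_prod (lshift k b)) v =
  block_mx (mpd a (gam g b) (lsubmx v)) 0 0 0.
Proof.
by rewrite (funext (gam_prodl b)) mpd_block !mpd_cst mpd_lsubmx.
Qed.

Let mpd_prodlr a b v : mpd (lshift k a) (gam_prod (rshift n b)) v = 0.
Proof.
rewrite (funext (gam_prodr b)) mpd_block !mpd_cst mpd_rsubmx0.
exact: block_mx_const.
Qed.

Let mpd_prodrl a b v : mpd (rshift n a) (gam_prod (lshift k b)) v = 0.
Proof.
rewrite (funext (gam_prodl b)) mpd_block !mpd_cst mpd_lsubmx0.
exact: block_mx_const.
Qed.

Let mpd_prodrr a b v : mpd (rshift n a) (gam_prod (rshift n b)) v =
  block_mx 0 0 0 (mpd a (gam h b) (rsubmx v)).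
Proof.
by rewrite (funext (gam_prodr b)) mpd_block !mpd_cst mpd_rsubmx.
Qed.

Lemma curv_prodll c d v : curv gam_prod (lshift k c) (lshift k d) v =
  block_mx (curv (gam g) c d (lsubmx v)) 0 0 0.
Proof.
rewrite /curv !mpd_prodll !gam_prodl !mulmx_block !(mul0mx, mulmx0, addr0).
by rewrite !opp_block_mx !add_block_mx !(oppr0, addr0).
Qed.

Lemma curv_prodrr c d v : curv gam_prod (rshift n c) (rshift n d) v =
  block_mx 0 0 0 (curv (gam h) c d (rsubmx v)).
Proof.
rewrite /curv !mpd_prodrr !gam_prodr !mulmx_block !(mul0mx, mulmx0, addr0, add0r).
by rewrite !opp_block_mx !add_block_mx !(oppr0, addr0).
Qed.

Lemma curv_prodlr c d v : curv gam_prod (lshift k c) (rshift n d) v = 0.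
Proof.
rewrite /curv mpd_prodlr mpd_prodrl subrr add0r gam_prodl gam_prodr !mulmx_block.
by rewrite !(mul0mx, mulmx0, addr0) subrr.
Qed.

Lemma curv_prodrl c d v : curv gam_prod (rshift n c) (lshift k d) v = 0.
Proof.
rewrite /curv mpd_prodlr mpd_prodrl subrr add0r gam_prodl gam_prodr !mulmx_block.
by rewrite !(mul0mx, mulmx0, addr0) subrr.
Qed.

(** The curvature is block diagonal and has no mixed components, because each
    block only depends on the coordinates of its own factor. *)
Theorem ricm_prod v : UW v ->
  ricm pg v = block_mx (ricm g (lsubmx v)) 0 0 (ricm h (rsubmx v)).
Proof.
move=> UWv; have [Uv Wv] := UWv; apply/matrixP => a b.
rewrite mxE (ricciE _ _ coord_metric_prod UWv) big_split_ord /=.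
under eq_bigr do rewrite curv_gam_prod //.
under [X in _ + X]eq_bigr do rewrite curv_gam_prod //.
case: (split_ordP b) => j ->.
- under [X in _ + X]eq_bigr do rewrite curv_prodrl mxE.
  rewrite [X in _ + X]big1 // addr0.
  under eq_bigr do rewrite curv_prodll.
  case: (split_ordP a) => i ->.
    rewrite block_mxEul mxE (ricciE _ _ mg Uv).
    by apply: eq_bigr => l _; rewrite block_mxEul.
  by rewrite block_mxEdl mxE big1 // => l _; rewrite block_mxEdl mxE.
- under eq_bigr do rewrite curv_prodlr mxE.
  rewrite big1 // add0r.
  under eq_bigr do rewrite curv_prodrr.
  case: (split_ordP a) => i ->.
    by rewrite block_mxEur mxE big1 // => l _; rewrite block_mxEur mxE.
  rewrite block_mxEdr mxE (ricciE _ _ mh Wv).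
  by apply: eq_bigr => l _; rewrite block_mxEdr.
Qed.

End ProductMetric.

(** * An obstruction to rigidity *)

Section Rigidity.
Context {R : realType}.

Lemma riemannian_coord_metric n (M : atlas R n) (g : metric M) (i : chart M) :
  riemannian g -> coord_metric (image_of i) (g i).
Proof.
move=> [[_ _ _ /(_ i)[_ oi _ _ _] _] [sg pg smg _]]; split => //.
- by move=> x; exact: sg.
- move=> x ix; rewrite unitmxE unitfE; apply/negP => /det0P[v v0 vg].
  by have := pg i x v ix v0; rewrite vg mul0mx mxE ltxx.
Qed.

Lemma ricci_dim1 (g : 'rV[R]_1 -> 'M[R]_1) a b x : ricci g a b x = 0.
Proof. by rewrite /ricci !big_ord1 !ord1 !subrr addr0. Qed.

Lemma image_of_prod n k (M : atlas R n) (N : atlas R k)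
    (c : chart (prod_atlas M N)) :
  image_of c = [set v | image_of c.1 (lsubmx v) /\ image_of c.2 (rsubmx v)].
Proof.
apply/seteqP; split => v /=.
- move=> [[p q] /= [dp dq] <-]; rewrite row_mxKl row_mxKr.
  by split; [exists p|exists q].
- move=> [[p dp pE] [q dq qE]]; exists (p, q) => //=.
  by rewrite pE qE hsubmxK.
Qed.

(** For Ric = c g the pencil Ric - mu g is (c - mu) g, of rank n unless c = mu,
    and zero then; so mu is simple only if n = 1. But curves are Ricci flat. *)
Lemma einstein_eigenvalue n (M : atlas R n) (g : metric M) (i : chart M) x mu :
  riemannian g -> einstein g -> image_of i x -> mu != 0 ->
  (\rank (ricm (g i) x - mu *: g i x)).+1 <> n.
Proof.
move=> rg [c gc] ix mu0; have [_ _ ug _] := riemannian_coord_metric i rg.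
have uix := ug x ix.
have -> : ricm (g i) x - mu *: g i x = (c - mu) *: g i x.
  apply/matrixP => a b; rewrite !mxE gc //.
  by move: (g i x a b) => z; ring.
have [cmu|cmu] := eqVneq c mu; last first.
  rewrite (eqmx_scale _ (_ : c - mu != 0)) ?subr_eq0 // mxrank_unit //.
  by move=> /esym/n_Sn.
rewrite cmu subrr scale0r mxrank0 => n1; subst n.
have := gc i x 0 0 ix; rewrite ricci_dim1 cmu => /esym/eqP.
rewrite mulf_eq0 (negbTE mu0) /= => /eqP g0.
by move: uix; rewrite unitmxE det_mx11 g0 unitr0.
Qed.

(** The multiplicity of mu adds up over the factors, and no factor contributes
    exactly one. *)
Lemma einstein_product_eigenvalue n (M : atlas R n) (g : metric M) :
  einstein_product g -> forall i : chart M,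
  coord_metric (image_of i) (g i) /\
  forall x mu, image_of i x -> mu != 0 ->
    (\rank (ricm (g i) x - mu *: g i x)).+1 <> n.
Proof.
elim=> {n M g} [n M g rg eg|n k M N g h _ IH rh eh] i.
  split; first exact: riemannian_coord_metric.
  by move=> x mu; exact: einstein_eigenvalue.
have [mg ng] := IH i.1; have mh := riemannian_coord_metric i.2 rh.
have mgh := coord_metric_prod mg mh.
split; first by rewrite image_of_prod; exact: mgh.
move=> v mu; rewrite image_of_prod => -[iv1 iv2] mu0.
rewrite /prod_metric (ricm_prod mg mh (conj iv1 iv2)).
rewrite scale_block_mx opp_block_mx add_block_mx !(scaler0, oppr0, addr0).
rewrite rank_diag_block_mx.
have := ng _ _ iv1 mu0; have := einstein_eigenvalue rh eh iv2 mu0.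
have := rank_leq_row (ricm (g i.1) (lsubmx v) - mu *: g i.1 (lsubmx v)).
have := rank_leq_row (ricm (h i.2) (rsubmx v) - mu *: h i.2 (rsubmx v)).
move: (\rank _) (\rank _) => r s; lia.
Qed.

(** The chartwise part of the manifold axioms. It passes to products at once and
    provides the open coordinate domains on which maps are differentiated. *)
Definition locally_euclidean n (M : atlas R n) : Prop :=
  (forall p : M, exists i : chart M, dom M i p) /\
  (forall i : chart M,
    [/\ open (dom M i), open (image_of i),
        forall p, dom M i p -> param M i (coords M i p) = p,
        forall p, dom M i p -> {for p, continuous (coords M i)} &
        forall x, image_of i x -> {for x, continuous (param M i)}]).

Lemma manifold_locally_euclidean n (M : atlas R n) :
  is_manifold M -> locally_euclidean M.
Proof. by case. Qed.

Lemma continuous_row_mx n k (T : topologicalType) (f : T -> 'rV[R]_n)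
    (g : T -> 'rV[R]_k) (p : T) :
  {for p, continuous f} -> {for p, continuous g} ->
  {for p, continuous (fun q => row_mx (f q) (g q))}.
Proof.
move=> cf cg; apply/cvgrPdist_lt => e e0.
move/cvgrPdist_lt : cf => /(_ e e0) cf; move/cvgrPdist_lt : cg => /(_ e e0) cg.
near=> q.
have fq : `|f p - f q| < e by near: q; exact: cf.
have gq : `|g p - g q| < e by near: q; exact: cg.
rewrite opp_row_mx add_row_mx [ltLHS]/Num.Def.normr /= mx_normrE.
apply: bigmax_lt => // -[a b] _ /=.
case: (split_ordP b) => j ->; rewrite ?row_mxEl ?row_mxEr.
- apply: le_lt_trans fq; rewrite [leRHS]/Num.Def.normr /= mx_normrE.
  exact: (le_bigmax _ _ (a, j)).
- apply: le_lt_trans gq; rewrite [leRHS]/Num.Def.normr /= mx_normrE.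
  exact: (le_bigmax _ _ (a, j)).
Unshelve. all: by end_near. Qed.

Lemma locally_euclidean_prod n k (M : atlas R n) (N : atlas R k) :
  locally_euclidean M -> locally_euclidean N ->
  locally_euclidean (prod_atlas M N).
Proof.
move=> [cM aM] [cN aN]; split.
  move=> [p q]; have [i ip] := cM p; have [j jq] := cN q.
  by exists (i, j).
move=> [i j]; have [oi oim iK ci cpi] := aM i; have [oj ojm jK cj cpj] := aN j.
split.
- have -> : dom (prod_atlas M N) (i, j) =
      (fst @^-1` dom M i) `&` (snd @^-1` dom N j) by [].
  by apply: openI; apply: open_comp => // x _; [exact: cvg_fst|exact: cvg_snd].
- rewrite image_of_prod.
  have -> : [set v | image_of i (lsubmx v) /\ image_of j (rsubmx v)] =
      (@lsubmx R 1 n k @^-1` image_of i) `&` (@rsubmx R 1 n k @^-1` image_of j).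
    by [].
  apply: openI; apply: open_comp => // x _; first exact: continuous_lsubmx.
  exact: continuous_rsubmx.
- by move=> [p q] /= [ip jq]; rewrite row_mxKl row_mxKr iK // jK.
- move=> [p q] /= [ip jq].
  apply: (@continuous_row_mx _ _ (M * N)%type (fun r => coords M i r.1)
    (fun r => coords N j r.2)).
    by apply: continuous_comp; [exact: cvg_fst|exact: ci].
  by apply: continuous_comp; [exact: cvg_snd|exact: cj].
- move=> v; rewrite image_of_prod => -[/= iv jv].
  have c1 := continuous_comp (@continuous_lsubmx R n k v) (cpi _ iv).
  have c2 := continuous_comp (@continuous_rsubmx R n k v) (cpj _ jv).
  exact: (cvg_pair c1 c2).
Qed.

Lemma einstein_product_locally_euclidean n (M : atlas R n) (g : metric M) :
  einstein_product g -> locally_euclidean M.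
Proof.
elim=> {n M g} [n M g [rg _] _|n k M N g h _ IH [rh _] _].
  exact: manifold_locally_euclidean.
by apply: locally_euclidean_prod => //; exact: manifold_locally_euclidean.
Qed.

Lemma coords_image_open n (M : atlas R n) (i : chart M) (A : set M) :
  locally_euclidean M -> open A -> open (coords M i @` (dom M i `&` A)).
Proof.
move=> [_ /(_ i)[oi oim ck cc cp]] oA.
have -> : coords M i @` (dom M i `&` A) =
    image_of i `&` param M i @^-1` (dom M i `&` A).
  apply/seteqP; split => x /=.
    by move=> [p [dp Ap] <-]; rewrite ck //; split => //; exists p.
  by move=> [[p dp <-]]; rewrite ck // => pA; exists p.
rewrite openE => x [ix xA].
have := cp x ix _ (open_nbhs_nbhs (conj (openI oi oA) xA)).
have := open_nbhs_nbhs (conj oim ix).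
exact: filterI.
Qed.

Lemma map_coords_image_open n k (M : atlas R n) (N : atlas R k) (f : M -> N)
    (i : chart M) (j : chart N) :
  locally_euclidean M -> locally_euclidean N -> continuous f ->
  open (coords M i @` (dom M i `&` f @^-1` dom N j)).
Proof.
move=> mM [_ /(_ j)[oj _ _ _ _]] cf; apply: coords_image_open => //.
by apply: open_comp => // x _; exact: cf.
Qed.

(** The Jacobians of the two maps at a point are mutually inverse matrices. *)
Lemma diffeo_dim n k (M : atlas R n) (N : atlas R k) (f : M -> N) (f' : N -> M)
    (x : M) :
  locally_euclidean M -> locally_euclidean N -> smooth_map f -> smooth_map f' ->
  cancel f f' -> cancel f' f -> n = k.
Proof.
move=> mM mN [cf sf] [cf' sf'] fK f'K.
have [/(_ x)[i ix] Mi] := mM; have [/(_ (f x))[j jx] Nj] := mN.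
have [_ _ ciK _ _] := Mi i; have [_ _ cjK _ _] := Nj j.
pose F := coords N j \o f \o param M i; pose G := coords M i \o f' \o param N j.
pose U := coords M i @` (dom M i `&` f @^-1` dom N j).
pose W := coords N j @` (dom N j `&` f' @^-1` dom M i).
have oU : open U by exact: map_coords_image_open.
have oW : open W by exact: map_coords_image_open.
pose y := coords M i x; pose z := coords N j (f x).
have Uy : U y by exists x.
have Wz : W z by exists (f x) => //; split => //=; rewrite /preimage /= fK.
have Fy : F y = z by rewrite /F /= ciK.
have Gz : G z = y by rewrite /G /= cjK // fK.
have dF : differentiable F y by exact: (sf i j [::]).
have dG : differentiable G z by exact: (sf' j i [::]).
have GF u : U u -> G (F u) = u.
  by move=> [p [ip jp] <-]; rewrite /F /G /= ciK // cjK // fK.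
have FG u : W u -> F (G u) = u.
  by move=> [p [jp ip] <-]; rewrite /F /G /= cjK // ciK // f'K.
have JGF : jac F y *m jac G z = 1%:M.
  rewrite -Fy -jac_comp ?Fy // -(jac_id y); apply/matrixP => a c; rewrite !jacE.
  by apply: (open_eq_pd a oU Uy) => u Uu; rewrite /= GF.
have JFG : jac G z *m jac F y = 1%:M.
  rewrite -Gz -jac_comp ?Gz // -(jac_id z); apply/matrixP => a c; rewrite !jacE.
  by apply: (open_eq_pd a oW Wz) => u Wu; rewrite /= FG.
apply/eqP; rewrite eqn_leq; apply/andP; split.
  rewrite -[leqLHS](mxrank1 R) -JGF (leq_trans (mxrankM_maxl _ _)) //.
  exact: rank_leq_col.
rewrite -[leqLHS](mxrank1 R) -JFG (leq_trans (mxrankM_maxl _ _)) //.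
exact: rank_leq_col.
Qed.

(** Local isometries transport the Ricci pencil by congruence, hence preserve
    the multiplicities of Ricci eigenvalues. *)
Lemma isometric_map_rank n (M N : atlas R n) (g : metric M) (h : metric N)
    (f : M -> N) (i : chart M) (j : chart N) (p : M) mu :
  locally_euclidean M -> locally_euclidean N ->
  coord_metric (image_of i) (g i) -> coord_metric (image_of j) (h j) ->
  isometric_map g h f -> dom M i p -> dom N j (f p) ->
  \rank (ricm (g i) (coords M i p) - mu *: g i (coords M i p)) =
  \rank (ricm (h j) (coords N j (f p)) - mu *: h j (coords N j (f p))).
Proof.
move=> mM mN [oi si ui smi] mh [[cf sf] pf] ip jp.
have [_ /(_ i)[_ _ ciK _ _]] := mM.
pose F := coords N j \o f \o param M i.
pose U := coords M i @` (dom M i `&` f @^-1` dom N j).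
have oU : open U by exact: map_coords_image_open.
have Ui : U `<=` image_of i by move=> _ [q [iq _] <-]; exists q.
have mgU : coord_metric U (g i).
  split=> // [x /Ui|x /Ui|a b s x /Ui]; [exact: si|exact: ui|exact: smi].
have UW x : U x -> image_of j (F x).
  by move=> [q [iq jq] <-]; exists (f q) => //; rewrite /F /= ciK.
have gE x : U x -> g i x = jac F x *m h j (F x) *m (jac F x)^T.
  move=> Ux; have dF : differentiable F x by exact: (sf i j [::]).
  move: Ux dF => [q [iq jq] <-] dF.
  by rewrite (pf i j q iq jq) jacobianE // {2}/F /= ciK.
have Up : U (coords M i p) by exists p.
have uJ := jac_unit mgU gE Up.
have FE : F (coords M i p) = coords N j (f p) by rewrite /F /= ciK.
rewrite (ricci_pullback mgU mh (sf i j) UW gE Up) (gE _ Up) -/F FE.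
rewrite scalemxAl scalemxAr -mulmxBl -mulmxBr.
rewrite mxrankMfree; last by rewrite row_free_unit unitmx_tr.
have fJ : row_full (jac F (coords M i p)) by rewrite row_full_unit.
by rewrite (eqmxMfull _ fJ).
Qed.

(** Both pencils are pulled back to the universal cover, where the multiplicity
    of mu would be one on account of M and different from one on account of the
    product. An Einstein metric is the case of a single factor. *)
Theorem simple_eigenvalue_not_rigid n (M : atlas R n) (g : metric M) (p0 : M) mu :
  riemannian g -> mu != 0 ->
  (forall (i : chart M) x, image_of i x ->
    (\rank (ricm (g i) x - mu *: g i x)).+1 = n) -> ~ rigid g.
Proof.
move=> rg mu0 simple; have [mM _] := rg.
have lM := manifold_locally_euclidean mM; have [charts _] := lM.
case=> [eg|[M' [g' [k [P [h [[rg' _ [p [[_ p_onto _] isop]]] ph]]]]]]].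
  have [i ip] := charts p0; have ix : image_of i (coords M i p0) by exists p0.
  by have := einstein_eigenvalue rg eg ix mu0; rewrite simple.
move=> [f [f' [fK f'K isof sf']]].
have [x _] := p_onto p0.
have lM' := manifold_locally_euclidean rg'.1.
have lP := einstein_product_locally_euclidean ph.
have nk := diffeo_dim x lM' lP isof.1 sf' fK f'K; subst k.
have [[chM' _] [chP _]] := (lM', lP).
have [i ix] := chM' x; have [j jx] := charts (p x); have [l lx] := chP (f x).
have [mh /(_ (coords P l (f x)) mu) nh] := einstein_product_eigenvalue ph l.
apply: nh => //; first by exists (f x).
have mg' := riemannian_coord_metric i rg'.
rewrite -(isometric_map_rank mu lM' lP mg' mh isof ix lx).
rewrite (isometric_map_rank mu lM' lM mg' (riemannian_coord_metric j rg) isop ix jx).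
by rewrite simple //; exists (p x).
Qed.

End Rigidity.

(** * Exponential polynomials *)

Section ExpPolynomials.
Context {R : realType} {n : nat}.

(** The metric, the group law and the potential of the example are all given by
    such expressions. Their partial derivatives are of the same kind, which
    yields smoothness and makes curvature a symbolic computation. *)
Inductive fexpr :=
| FC of R | FV of 'I_n | FAdd of fexpr & fexpr | FMul of fexpr & fexpr
| FExp of fexpr.

Fixpoint feval (e : fexpr) (x : 'rV[R]_n) : R :=
  match e with
  | FC c => c
  | FV i => x 0 i
  | FAdd e f => feval e x + feval f x
  | FMul e f => feval e x * feval f x
  | FExp e => expR (feval e x)
  end.

Fixpoint fderiv (a : 'I_n) (e : fexpr) : fexpr :=
  match e with
  | FC _ => FC 0
  | FV i => FC (a == i)%:R
  | FAdd e f => FAdd (fderiv a e) (fderiv a f)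
  | FMul e f => FAdd (FMul (fderiv a e) f) (FMul e (fderiv a f))
  | FExp e => FMul (fderiv a e) (FExp e)
  end.

Lemma differentiable_expR (t : R) : differentiable (@expR R) t.
Proof. exact/derivable1_diffP/derivable_expR. Qed.

Lemma differentiable_feval e x : differentiable (feval e) x.
Proof.
elim: e => [c|i|e IHe f IHf|e IHe f IHf|e IHe] /=.
- exact: differentiable_cst.
- exact: differentiable_coord.
- exact: differentiableD.
- exact: differentiableM.
- exact: (differentiable_comp (g := @expR R) IHe (differentiable_expR _)).
Qed.

Lemma pd_feval a e x : pd a (feval e) x = feval (fderiv a e) x.
Proof.
elim: e => [c|i|e IHe f IHf|e IHe f IHf|e IHe] /=.
- exact: pd_cst.
- exact: pd_coord.
- by rewrite pdD ?IHe ?IHf //; exact: differentiable_feval.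
- by rewrite pdM ?IHe ?IHf //; exact: differentiable_feval.
- have de := differentiable_feval e x.
  have dx := differentiable_expR (feval e x).
  have -> : (fun y => expR (feval e y)) = @expR R \o feval e by [].
  rewrite pdE; last exact: differentiable_comp.
  rewrite diff_comp //= -(pdE a de) IHe -[X in 'd _ _ X]mulr1.
  rewrite -[feval _ x * 1]/(_ *: 1) linearZ /= -deriveE // derive_val.
  by [].
Qed.

Lemma foldr_pd_feval s e :
  foldr (fun a h => pd a h) (feval e) s = feval (foldr fderiv e s).
Proof.
elim: s => [//|a s IH] /=; rewrite IH; apply/funext => x; exact: pd_feval.
Qed.

Lemma smooth_feval (U : set 'rV[R]_n) e : smooth_on U (feval e).
Proof.
by move=> s x _; rewrite foldr_pd_feval; exact: differentiable_feval.
Qed.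

Section Rows.
Context {m : nat}.
Implicit Types e : 'I_m -> fexpr.

Definition fevals e (x : 'rV[R]_n) : 'rV[R]_m := \row_j feval (e j) x.

Lemma differentiable_fevals e x : differentiable (fevals e) x.
Proof.
have -> : fevals e = \sum_j (fun y => feval (e j) y *: delta_mx 0 j).
  apply/funext => y; rewrite fct_sumE [LHS]row_sum_delta.
  by apply: eq_bigr => j _; rewrite mxE.
apply: differentiable_sum => j; apply: differentiableZl.
exact: differentiable_feval.
Qed.

Lemma pd_fevals a e x :
  pd a (fevals e) x = fevals (fun j => fderiv a (e j)) x.
Proof.
rewrite /pd derive_mx; last exact/diff_derivable/differentiable_fevals.
apply/rowP => j; rewrite !mxE -pd_feval.
by apply: eq_pd => y; rewrite mxE.
Qed.

Lemma smooth_fevals (U : set 'rV[R]_n) e : smooth_on U (fevals e).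
Proof.
move=> s x _.
have -> : foldr (fun a h => pd a h) (fevals e) s =
    fevals (fun j => foldr fderiv (e j) s).
  by elim: s => [//|a s IH] /=; rewrite IH; apply/funext => y; exact: pd_fevals.
exact: differentiable_fevals.
Qed.

Lemma continuous_fevals e : continuous (fevals e).
Proof. by move=> x; apply/differentiable_continuous/differentiable_fevals. Qed.

Lemma jac_fevals e x a j : jac (fevals e) x a j = feval (fderiv a (e j)) x.
Proof.
by rewrite jacE -pd_feval; apply: eq_pd => y; rewrite mxE.
Qed.

End Rows.
End ExpPolynomials.

(** * Coordinate space as a manifold *)

Section EuclideanAtlas.
Context {R : realType}.

Definition euclid n : atlas R n :=
  @Atlas R n 'rV[R]_n unit (fun=> setT) (fun _ p => p) (fun _ x => x).

Lemma image_of_euclid n (i : chart (euclid n)) : image_of i = setT.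
Proof. by apply/seteqP; split => // x _; exists x. Qed.

Lemma smooth_on_id n (U : set 'rV[R]_n) : smooth_on U (fun x => x).
Proof.
have -> : (fun x : 'rV[R]_n => x) = fevals (@FV R n).
  by apply/funext => x; apply/rowP => j; rewrite mxE.
exact: smooth_fevals.
Qed.

Lemma hausdorff_rV n : hausdorff_space 'rV[R]_n.
Proof. exact: norm_hausdorff. Qed.

Lemma rational_approx (x e : R) : 0 < e -> exists q : rat, `|x - ratr q| < e.
Proof.
move=> e0; have lt : x - e < x + e by lra.
have [q] := rat_in_itvoo lt.
rewrite in_itv /= => /andP[h1 h2]; exists q.
by rewrite ltr_norml; apply/andP; split; lra.
Qed.

(** The balls with rational centre and radius 1 / (k + 1) form a basis. *)
Lemma second_countable_rV n : @second_countable 'rV[R]_n.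
Proof.
pose b (c : 'rV[rat]_n * nat) : set 'rV[R]_n :=
  ball (map_mx (@ratr R) c.1) (c.2.+1%:R^-1).
exists (range b).
  exact: sub_countable (card_image_le _ _) (countableP _).
split; first by move=> _ [[q k] _ <-]; exact: ball_open.
move=> x A /= /nbhs_ballP[e /= e0 eA].
have [k _ /(_ k (leqnn k)) /= ke] :=
  near_infty_natSinv_lt (PosNum (divr_gt0 e0 (ltr0Sn R 1))).
have k0 : 0 < k.+1%:R^-1 :> R by rewrite invr_gt0.
pose q : 'rV[rat]_n := \row_j sval (cid (rational_approx (x 0 j) k0)).
have qx : ball (map_mx (@ratr R) q) (k.+1%:R^-1) x.
  rewrite -ball_normE /= distrC [ltLHS]/Num.Def.normr /= mx_normrE.
  apply: bigmax_lt => // -[a j] _ /=; rewrite !mxE (ord1 a).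
  by case: (cid _).
exists (b (q, k)); first by split => //; exists (q, k).
move=> y qy; apply: eA; apply: (@ball_splitr _ _ (map_mx (@ratr R) q)).
  exact: le_ball (ltW ke) _ qx.
exact: le_ball (ltW ke) _ qy.
Qed.

Lemma euclid_manifold n : is_manifold (euclid n).
Proof.
split.
- exact: hausdorff_rV.
- exact: second_countable_rV.
- by move=> p; exists tt.
- move=> i; split.
  + exact: openT.
  + by rewrite image_of_euclid; exact: openT.
  + by [].
  + by move=> p _; exact: cvg_id.
  + by move=> p _; exact: cvg_id.
- by move=> i j; exact: smooth_on_id.
Qed.

End EuclideanAtlas.

(** * A criterion for completeness *)

Section CurveLength.
Context {R : realType}.
Local Notation mu := (@lebesgue_measure R).

Lemma continuous_measurableE (D : set R) (f : R -> R) : measurable D ->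
  continuous f -> measurable_fun D (EFin \o f).
Proof.
move=> mD cf; apply/measurable_EFinP; apply: measurable_funTS.
exact: continuous_measurable_fun.
Qed.

(** The derivative is integrated over [0, tau], and the integral of the speed
    over that interval is at most the whole length. *)
Lemma increment_le_length (f s : R -> R) (K L tau : R) :
  (forall t, derivable f t 1) -> continuous (derive1 f) -> continuous s ->
  (forall t, 0 <= s t) -> 0 <= K -> 0 <= tau <= 1 ->
  (forall t, 0 <= t <= tau -> `|derive1 f t| <= K * s t) ->
  (\int[mu]_(t in `[0%R, 1%R]) (s t)%:E = L%:E)%E ->
  `|f tau - f 0| <= K * L.
Proof.
move=> df cf' cs s0 K0 /andP[tau0 tau1] fs sL.
have L0 : 0 <= L.
  by rewrite -lee_fin -sL; apply: integral_ge0 => t _; rewrite lee_fin.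
have [->|tau_neq] := eqVneq tau 0; first by rewrite subrr normr0 mulr_ge0.
have tau_gt : 0 < tau by rewrite lt_def tau_neq.
have cf t : {for t, continuous f}.
  exact/differentiable_continuous/derivable1_diffP.
have ftc : (\int[mu]_(t in `[0%R, tau]) (derive1 f t)%:E = (f tau)%:E - (f 0)%:E)%E.
  apply: (continuous_FTC2 tau_gt).
  - exact: continuous_subspaceT.
  - split; [by move=> x _; exact: df|exact/cvg_at_right_filter/cf|].
    exact/cvg_at_left_filter/cf.
  - by [].
have ms D : measurable D -> measurable_fun D (EFin \o s).
  by move=> mD; exact: continuous_measurableE.
rewrite -lee_fin EFinM -sL -[(`|_|)%:E]/(`|(f tau)%:E - (f 0)%:E|)%E -ftc.
apply: (le_trans (le_abse_integral _ _ _)) => //.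
  exact: continuous_measurableE.
apply: (@le_trans _ _ (\int[mu]_(t in `[0%R, tau]) (K%:E * (s t)%:E))%E).
  apply: ge0_le_integral => //.
  - by apply: measurableT_comp => //; exact: continuous_measurableE.
  - by apply: measurable_funeM; exact: ms.
rewrite ge0_integralZl_EFin //; last exact: ms.
apply: lee_wpmul2l => //.
apply: ge0_subset_integral => //; first exact: ms.
- by move=> t _; rewrite lee_fin.
- by move=> t /=; rewrite !in_itv /= => /andP[-> tt] /=; exact: le_trans tt tau1.
- by move=> t _; rewrite lee_fin.
Qed.

Lemma integral_le_bound (s : R -> R) (K : R) : continuous s ->
  (forall t, 0 <= s t) -> (forall t, 0 <= t <= 1 -> s t <= K) ->
  (\int[mu]_(t in `[0%R, 1%R]) (s t)%:E <= K%:E)%E.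
Proof.
move=> cs s0 sK.
apply: (@le_trans _ _ (\int[mu]_(t in `[0%R, 1%R]) (cst K%:E t))%E).
  apply: ge0_le_integral => //.
  - by move=> t _; rewrite lee_fin.
  - exact: continuous_measurableE.
rewrite integral_cst //= lebesgue_measure_itv /= lte01.
by rewrite oppr0 adde0 mule1.
Qed.

End CurveLength.

Section CompletenessCriterion.
Context {R : realType} {n : nat}.
Variable g : metric (@euclid R n).
Hypothesis mg : is_metric g.
Local Notation mu := (@lebesgue_measure R).

Definition qform (x v : 'rV[R]_n) : R := (v *m g tt x *m v^T) 0 0.

Lemma qform_continuous (c v : R -> 'rV[R]_n) :
  continuous c -> continuous v -> continuous (fun t => qform (c t) (v t)).
Proof.
move=> cc cv.
have -> : (fun t => qform (c t) (v t)) =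
    (fun t => \sum_j (\sum_i v t 0 i * g tt (c t) i j) * v t 0 j).
  apply/funext => t; rewrite /qform mxE; apply: eq_bigr => j _.
  by rewrite !mxE; congr (_ * _); apply: eq_bigr => i _; rewrite mxE.
have cvi i : continuous (fun t => v t 0 i).
  by move=> t; apply: (@continuous_comp _ _ _ v (fun z : 'rV[R]_n => z 0 i));
    [exact: cv|exact: coord_continuous].
have [_ _ sg _] := mg.
have cg i j : continuous (fun t => g tt (c t) i j).
  move=> t; apply: (@continuous_comp _ _ _ c (fun x => g tt x i j)); first exact: cc.
  apply: differentiable_continuous; apply: (sg tt i j [::]).
  by rewrite image_of_euclid.
have csum (F : 'I_n -> R -> R) : (forall i, continuous (F i)) ->
    continuous (fun t => \sum_i F i t).
  move=> cF; rewrite (_ : (fun t => _) = \sum_i F i); last first.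
    by apply/funext => t; rewrite fct_sumE.
  elim/big_ind : _ => [|f h cf ch t|i _]; last exact: cF.
    by move=> t; exact: cvg_cst.
  by apply: cvgD; [exact: cf|exact: ch].
apply: (csum _ _) => j t; apply: cvgM; last exact: cvi.
by apply: (csum _ _) => i u; apply: cvgM; [exact: cvi|exact: cg].
Qed.

(** Lengths are compared with the coordinate norm in both directions, on bounded
    regions only. *)
Hypothesis lower : forall B : R, exists2 K : R, 0 < K &
  forall (c : R -> 'rV[R]_n) (s : R -> R) (L : R),
    (forall t, derivable c t 1) -> continuous (derive1 c) -> continuous s ->
    (forall t, s t = Num.sqrt (qform (c t) (derive1 c t))) ->
    `|c 0| <= B ->
    (\int[mu]_(t in `[0%R, 1%R]) (s t)%:E = L%:E)%E -> L <= 1 ->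
    `|c 1 - c 0| <= K * L.
Hypothesis upper : forall B : R, exists2 K : R, 0 < K &
  forall x v : 'rV[R]_n, `|x| <= B -> Num.sqrt (qform x v) <= K * `|v|.

Lemma rdist_lower (B : R) : exists2 K : R, 0 < K &
  forall (p q : 'rV[R]_n) (e : R), `|p| <= B -> e <= 1 ->
    (rdist g p q < e%:E)%E -> `|q - p| <= K * e.
Proof.
have [K K0 HK] := lower B; exists K => // p q e pB e1.
move=> /ereal_inf_lt[l [c [s [[cc dc] c0 c1 sp lE]]] le].
have s0 t : 0 <= s t by rewrite (sp t tt).
have l0 : (0 <= l)%E by rewrite lE; apply: integral_ge0 => t _; rewrite lee_fin.
have lfin : l \is a fin_num by rewrite ge0_fin_numE // (lt_trans le) // ltry.
have dc1 t : derivable c t 1 := (dc t tt I).1.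
have cc' : continuous (derive1 c) := fun t => (dc t tt I).2.
have sE t : s t = Num.sqrt (qform (c t) (derive1 c t)) by rewrite (sp t tt).
have cs : continuous s.
  rewrite (funext sE) => t.
  apply: (@continuous_comp _ _ _ (fun t => qform (c t) (derive1 c t)) Num.sqrt).
    exact: qform_continuous.
  exact: sqrt_continuous.
have fle : fine l < e by rewrite -lte_fin fineK.
have := HK c s (fine l) dc1 cc' cs sE; rewrite c0 c1 fineK // => /(_ pB (esym lE)).
move=> /(_ (le_trans (ltW fle) e1)) /le_trans; apply.
by rewrite ler_wpM2l ?ltW.
Qed.

(** The length of a coordinate segment bounds the distance from above. *)
Lemma rdist_upper (B : R) : exists2 K : R, 0 < K &
  forall (p q : 'rV[R]_n), `|p| <= B -> `|q| <= B ->
    (rdist g p q <= (K * `|q - p|)%:E)%E.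
Proof.
have [K K0 HK] := upper B; exists K => // p q pB qB.
pose c (t : R) : 'rV[R]_n := t *: (q - p) + p.
have ic (t : R) : is_derive t 1 c (q - p).
  rewrite -[X in is_derive _ _ _ X]addr0; apply: is_deriveD.
  rewrite -[X in is_derive _ _ _ X]scale1r.
  apply: DeriveDef; first exact/derivable1_diffP.
  by rewrite deriveE // diff_val.
have dc t : derive1 c t = q - p by rewrite derive1E derive_val.
have cc : continuous c.
  move=> t; apply/differentiable_continuous/derivable1_diffP.
  by have [] := ic t.
pose s t := Num.sqrt (qform (c t) (q - p)).
have cs : continuous s.
  move=> t; apply: (@continuous_comp _ _ _ (fun t => qform (c t) (q - p)) Num.sqrt).
    by apply: (qform_continuous cc) => u; exact: cvg_cst.
  exact: sqrt_continuous.
have sK t : 0 <= t <= 1 -> s t <= K * `|q - p|.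
  move=> /andP[t0 t1]; apply: HK.
  have -> : c t = t *: q + (1 - t) *: p.
    by rewrite /c scalerBr scalerBl scale1r -addrA [- _ + _]addrC.
  rewrite (le_trans (ler_normD _ _)) // !normrZ (ger0_norm t0).
  rewrite (@ger0_norm _ (1 - t)) ?subr_ge0 //.
  have h1 : t * `|q| <= t * B by rewrite ler_wpM2l.
  have h2 : (1 - t) * `|p| <= (1 - t) * B by rewrite ler_wpM2l // subr_ge0.
  by rewrite (le_trans (lerD h1 h2)) // -mulrDl addrC subrK mul1r.
apply: le_trans (integral_le_bound cs _ sK); last by move=> t; exact: sqrtr_ge0.
have dct (t : R) : derivable c t 1 by have [] := ic t.
have cdc : continuous (derive1 c).
  have -> : derive1 c = fun=> q - p by apply/funext => u; exact: dc.
  by move=> t; exact: cvg_cst.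
apply: ereal_inf_lbound; exists c, s; split.
- by split; [exact: cc|move=> t i _; exact: (conj (dct t) (cdc t))].
- by rewrite /c scale0r add0r.
- by rewrite /c scale1r subrK.
- by move=> t [] _ /=; rewrite /s -(dc t).
- by [].
Qed.

(** A Cauchy sequence stays within distance one of one of its terms, hence in a
    bounded region. There it is a Cauchy sequence for the coordinate norm, and
    its limit in coordinates is also its limit for the metric. *)
Theorem complete_criterion : complete_metric g.
Proof.
move=> u cu.
have [K0 K0_gt low0] := rdist_lower `|u (sval (cid (cu 1 ltr01)))|.
move: low0; case: (cid _) => N0 /= HN0 low0.
pose B := `|u N0| + K0 + 1.
have uB k : (N0 <= k)%N -> `|u k| <= B - 1.
  move=> Nk; have := low0 (u N0) (u k) 1 (lexx _) (lexx _) (HN0 _ _ (leqnn _) Nk).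
  rewrite mulr1 /B addrK => h.
  rewrite -[u k](subrK (u N0)) addrC (le_trans (ler_normD _ _)) //.
  by rewrite lerD2l.
have [K K_gt lowK] := rdist_lower B.
have uB' k : (N0 <= k)%N -> `|u k| <= B.
  by move=> /uB h; rewrite (le_trans h) // gerBl.
have cauchy_u : cauchy (u @ \oo).
  apply/cauchy_exP => e e0.
  pose d := Num.min 1 (e / K / 2).
  have d0 : 0 < d by rewrite lt_min ltr01 !divr_gt0.
  have [N HN] := cu d d0.
  exists (u (maxn N0 N)); exists (maxn N0 N) => // k /= Nk.
  rewrite -ball_normE /= distrC.
  have := lowK (u (maxn N0 N)) (u k) d (uB' _ (leq_maxl _ _)) _
    (HN _ _ (leq_maxr _ _) (leq_trans (leq_maxr _ _) Nk)).
  rewrite ge_min lexx => /(_ isT) /le_lt_trans; apply.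
  apply: (@le_lt_trans _ _ (K * (e / K / 2))).
    by apply: ler_wpM2l; [exact: ltW|rewrite ge_min lexx orbT].
  by rewrite mulrA mulrCA divff ?gt_eqF // mulr1 ltr_pdivrMr // ltr_pMr // ltr1n.
have /cauchy_cvgP/cvg_ex[/= x ux] := cauchy_u.
have [K' K'_gt upK] := rdist_upper B.
have xB : `|x| <= B.
  have /cvgrPdist_lt/(_ 1 ltr01)[N _ HN] := ux.
  have := HN (maxn N N0) (leq_maxl _ _) => /= h.
  rewrite -[x](subrK (u (maxn N N0))) (le_trans (ler_normD _ _)) //.
  by rewrite -[B](subrK 1) addrC lerD ?uB ?leq_maxr // ltW.
exists x => e e0.
have [N _ HN] := (cvgrPdist_lt _ _).1 ux (e / K') (divr_gt0 e0 K'_gt).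
exists (maxn N N0) => k; rewrite geq_max => /andP[Nk N0k].
apply: le_lt_trans (upK _ _ (uB' _ N0k) xB) _.
rewrite lte_fin mulrC -ltr_pdivlMr //.
exact: (HN k Nk).
Qed.

End CompletenessCriterion.

(** * The metric of the example *)

Definition i0 : 'I_4 := @Ordinal 4 0 isT.
Definition i1 : 'I_4 := @Ordinal 4 1 isT.
Definition i2 : 'I_4 := @Ordinal 4 2 isT.
Definition i3 : 'I_4 := @Ordinal 4 3 isT.

Lemma ord4_ind (P : 'I_4 -> Prop) : P i0 -> P i1 -> P i2 -> P i3 -> forall i, P i.
Proof.
move=> p0 p1 p2 p3 [[|[|[|[|i]]]] Hi] //.
- by rewrite (_ : Ordinal _ = i0) //; exact: val_inj.
- by rewrite (_ : Ordinal _ = i1) //; exact: val_inj.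
- by rewrite (_ : Ordinal _ = i2) //; exact: val_inj.
- by rewrite (_ : Ordinal _ = i3) //; exact: val_inj.
Qed.

Lemma sum4 (V : nmodType) (F : 'I_4 -> V) :
  \sum_(i < 4) F i = F i0 + F i1 + F i2 + F i3.
Proof.
rewrite !big_ord_recl big_ord0 addr0 !addrA.
by congr (_ + _ + _ + _); congr F; exact: val_inj.
Qed.

Section Metric.
Context {R : realType}.
Variable A : R.
Hypothesis A1 : 1 <= A.
Implicit Types (x v : 'rV[R]_4).

Definition expu : @fexpr R 4 := FExp (FV i0).
Definition sq (e : @fexpr R 4) := FMul e e.

Definition heis_fexpr (i j : 'I_4) : @fexpr R 4 :=
  match nat_of_ord i, nat_of_ord j with
  | 0, 0 => FC A
  | 1, 1 => sq expu
  | 2, 2 => FAdd (sq expu) (FMul (sq (FV i1)) (sq (sq expu)))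
  | 2, 3 | 3, 2 => FMul (FC (-1)) (FMul (FV i1) (sq (sq expu)))
  | 3, 3 => sq (sq expu)
  | _, _ => FC 0
  end%N.

(** A du^2 + e^(2u) (dx^2 + dy^2) + e^(4u) (dz - x dy)^2 in the coordinates
    (u, x, y, z). *)
Definition heis_metric : metric (@euclid R 4) :=
  fun _ x => \matrix_(i, j) feval (heis_fexpr i j) x.

Lemma heis_qform x v : qform heis_metric x v =
  A * v 0 i0 ^+ 2 + (expR (x 0 i0) * v 0 i1) ^+ 2
  + (expR (x 0 i0) * v 0 i2) ^+ 2
  + (expR (x 0 i0) ^+ 2 * (v 0 i3 - x 0 i1 * v 0 i2)) ^+ 2.
Proof.
rewrite /qform !mxE sum4 !mxE !sum4 !mxE /=.
ring.
Qed.

Lemma heis_is_metric : is_metric heis_metric.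
Proof.
split.
- move=> i x _; apply/matrixP => a b; rewrite !mxE.
  by elim/ord4_ind: a; elim/ord4_ind: b.
- move=> [] x v _ v0; rewrite -/(qform heis_metric x v) heis_qform.
  rewrite lt_def; apply/andP; split; last first.
    by rewrite !addr_ge0 ?sqr_ge0 // mulr_ge0 ?sqr_ge0 // (le_trans ler01).
  apply: contra v0 => q0.
  have A0 : 0 <= A * v 0 i0 ^+ 2 by rewrite mulr_ge0 ?sqr_ge0 // (le_trans ler01).
  have e0 : expR (x 0 i0) != 0 by rewrite gt_eqF ?expR_gt0.
  have AN0 : A != 0 by rewrite gt_eqF // (lt_le_trans ltr01).
  move: q0; rewrite !paddr_eq0 ?addr_ge0 ?sqr_ge0 //.
  rewrite !sqrf_eq0 !mulf_eq0 ?orbb (negbTE e0) (negbTE AN0) /=.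
  move=> /andP[/andP[/andP[/eqP v0 /eqP v1] /eqP v2]].
  rewrite v2 mulr0 subr0 => /eqP v3.
  by apply/eqP/rowP; elim/ord4_ind; rewrite mxE.
- move=> i a b; rewrite (_ : (fun x => _) = feval (heis_fexpr a b)).
    exact: smooth_feval.
  by apply/funext => x; rewrite mxE.
- move=> [] [] p _ _ /=; rewrite (_ : _ \o _ = id) //.
  by rewrite jacobianE // jac_id mul1mx trmx1 mulmx1.
Qed.

Lemma heis_riemannian : riemannian heis_metric.
Proof. by split; [exact: euclid_manifold|exact: heis_is_metric]. Qed.

Lemma norm_coord_le n (v : 'rV[R]_n) j : `|v 0 j| <= `|v|.
Proof.
rewrite [leRHS]/Num.Def.normr /= mx_normrE.
exact: (le_bigmax _ (fun i : 'I_1 * 'I_n => `|v i.1 i.2|) (0, j)).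
Qed.

Lemma norm_rV_le n (v : 'rV[R]_n) (K : R) : 0 <= K ->
  (forall j, `|v 0 j| <= K) -> `|v| <= K.
Proof.
move=> K0 vK; rewrite [leLHS]/Num.Def.normr /= mx_normrE.
by apply: bigmax_le => // -[a j] _ /=; rewrite (ord1 a).
Qed.

Lemma heis_upper (B : R) : exists2 K : R, 0 < K &
  forall x v, `|x| <= B -> Num.sqrt (qform heis_metric x v) <= K * `|v|.
Proof.
pose E := expR B.
have E0 : 0 < E by exact: expR_gt0.
exists (A + E + E + E ^+ 2 * (1 + `|B|)).
  by rewrite !addr_gt0 ?mulr_gt0 ?exprn_gt0 ?ltr_wpDr ?normr_ge0 // (lt_le_trans ltr01).
move=> x v xB; rewrite heis_qform.
have sB k : `|v 0 k| <= `|v| by exact: norm_coord_le.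
have eE : expR (x 0 i0) <= E.
  by rewrite ler_expR (le_trans (ler_norm _)) // (le_trans (norm_coord_le _ _)).
have e0 := expR_gt0 (x 0 i0).
have x1 : `|x 0 i1| <= `|B|.
  by rewrite (le_trans (norm_coord_le _ _)) // (le_trans xB) // ler_norm.
set N := `|v|; have N0 : 0 <= N by exact: normr_ge0.
have sqle (a b : R) : `|a| <= b -> a ^+ 2 <= b ^+ 2.
  move=> ab; rewrite -[a ^+ 2]real_normK ?num_real // ler_sqr ?nnegrE //.
  exact: le_trans (normr_ge0 _) ab.
have A0 : 0 <= A by exact: le_trans ler01 A1.
have h0 : A * v 0 i0 ^+ 2 <= (A * N) ^+ 2.
  rewrite exprMn; apply: ler_pM => //; first exact: sqr_ge0.
    by rewrite expr2 ler_peMr.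
  exact: sqle.
have hE k : (expR (x 0 i0) * v 0 k) ^+ 2 <= (E * N) ^+ 2.
  apply: sqle; rewrite normrM (gtr0_norm e0).
  by apply: ler_pM => //; exact: ltW.
have h3 : (expR (x 0 i0) ^+ 2 * (v 0 i3 - x 0 i1 * v 0 i2)) ^+ 2 <=
    (E ^+ 2 * ((1 + `|B|) * N)) ^+ 2.
  apply: sqle; rewrite normrM ger0_norm ?sqr_ge0 //.
  apply: ler_pM => //.
    by rewrite ler_sqr // nnegrE ltW.
  rewrite mulrDl mul1r (le_trans (ler_normB _ _)) // lerD // normrM.
  by apply: ler_pM.
set q := (X in Num.sqrt X).
have p0 : 0 <= A * N by rewrite mulr_ge0.
have p1 : 0 <= E * N by rewrite mulr_ge0 // ltW.
have p3 : 0 <= E ^+ 2 * ((1 + `|B|) * N).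
  by apply: mulr_ge0; [exact: sqr_ge0|apply: mulr_ge0 => //; exact: addr_ge0].
set K := (X in _ <= X * N).
have KE : K * N = A * N + E * N + E * N + E ^+ 2 * ((1 + `|B|) * N).
  by rewrite /K; ring.
have KN0 : 0 <= K * N by rewrite KE !addr_ge0.
rewrite -(ger0_norm KN0) -sqrtr_sqr; apply: ler_wsqrtr.
rewrite KE /q.
apply: (le_trans (lerD (lerD (lerD h0 (hE i1)) (hE i2)) h3)).
move: (A * N) (E * N) (E ^+ 2 * _) p0 p1 p3 => a b c a0 b0 c0.
rewrite -subr_ge0.
have -> : (a + b + b + c) ^+ 2 - (a ^+ 2 + b ^+ 2 + b ^+ 2 + c ^+ 2) =
   2 * (a * b + a * b + b * b + (a + b + b) * c) by ring.
by rewrite mulr_ge0 // !addr_ge0 ?mulr_ge0 ?addr_ge0.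
Qed.

(** Since A >= 1, the coordinate u changes by at most the length, so that e^u
    stays bounded below on a short curve. This controls x and y, and then z
    through the last term of the metric. *)
Lemma heis_lower (B : R) : exists2 K : R, 0 < K &
  forall (c : R -> 'rV[R]_4) (s : R -> R) (L : R),
    (forall t, derivable c t 1) -> continuous (derive1 c) -> continuous s ->
    (forall t, s t = Num.sqrt (qform heis_metric (c t) (derive1 c t))) ->
    `|c 0| <= B ->
    (\int[lebesgue_measure]_(t in `[0%R, 1%R]) (s t)%:E = L%:E)%E -> L <= 1 ->
    `|c 1 - c 0| <= K * L.
Proof.
pose K1 := expR (B + 1).
have K10 : 0 < K1 by exact: expR_gt0.
pose K3 := K1 ^+ 2 + (`|B| + K1) * K1.
have K30 : 0 < K3.
  by rewrite ltr_wpDr ?exprn_gt0 // mulr_ge0 ?addr_ge0 // ltW.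
exists (1 + K1 + K3); first by apply: addr_gt0 => //; exact: addr_gt0.
move=> c s L dc cc' cs sE cB sL L1.
have s0 t : 0 <= s t by rewrite sE sqrtr_ge0.
have L0 : 0 <= L.
  by rewrite -lee_fin -sL; apply: integral_ge0 => t _; rewrite lee_fin.
pose f i (t : R) := c t 0 i.
have df i t : derivable (f i) t 1 by have /derivable_mxP := dc t; apply.
have fE i t : derive1 (f i) t = derive1 c t 0 i.
  by rewrite !derive1E derive_mx // mxE.
have cf i : continuous (derive1 (f i)).
  rewrite (funext (fE i)) => t.
  apply: (@continuous_comp _ _ _ (derive1 c) (fun z : 'rV[R]_4 => z 0 i)).
    exact: cc'.
  exact: coord_continuous.
have inc i K tau := @increment_le_length R (f i) s K L tau (df i) (cf i) cs s0.
have sqs (a b t : R) : 0 <= b -> a ^+ 2 + b = qform heis_metric (c t) (derive1 c t) ->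
    `|a| <= s t.
  move=> b0 ab; rewrite -sqrtr_sqr sE; apply: ler_wsqrtr.
  by rewrite -ab lerDl.
pose x t := expR (f i0 t); have x0 t : 0 < x t by exact: expR_gt0.
have A0 : 0 <= A by exact: le_trans ler01 A1.
have d0 t : `|derive1 (f i0) t| <= s t.
  apply: (sqs _ ((A - 1) * derive1 c t 0 i0 ^+ 2 +
     (x t * derive1 c t 0 i1) ^+ 2 + (x t * derive1 c t 0 i2) ^+ 2 +
     (x t ^+ 2 * (derive1 c t 0 i3 - f i1 t * derive1 c t 0 i2)) ^+ 2)).
    by rewrite !addr_ge0 ?sqr_ge0 // mulr_ge0 ?sqr_ge0 // subr_ge0.
  by rewrite heis_qform fE /x /f; ring.
have d1 t : `|x t * derive1 (f i1) t| <= s t.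
  apply: (sqs _ (A * derive1 c t 0 i0 ^+ 2 + (x t * derive1 c t 0 i2) ^+ 2 +
     (x t ^+ 2 * (derive1 c t 0 i3 - f i1 t * derive1 c t 0 i2)) ^+ 2)).
    by rewrite !addr_ge0 ?sqr_ge0 // mulr_ge0 ?sqr_ge0.
  by rewrite heis_qform fE /x /f; ring.
have d2 t : `|x t * derive1 (f i2) t| <= s t.
  apply: (sqs _ (A * derive1 c t 0 i0 ^+ 2 + (x t * derive1 c t 0 i1) ^+ 2 +
     (x t ^+ 2 * (derive1 c t 0 i3 - f i1 t * derive1 c t 0 i2)) ^+ 2)).
    by rewrite !addr_ge0 ?sqr_ge0 // mulr_ge0 ?sqr_ge0.
  by rewrite heis_qform fE /x /f; ring.
have d3 t : `|x t ^+ 2 * (derive1 (f i3) t - f i1 t * derive1 (f i2) t)| <= s t.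
  apply: (sqs _ (A * derive1 c t 0 i0 ^+ 2 + (x t * derive1 c t 0 i1) ^+ 2 +
     (x t * derive1 c t 0 i2) ^+ 2)).
    by rewrite !addr_ge0 ?sqr_ge0 // mulr_ge0 ?sqr_ge0.
  by rewrite heis_qform !fE /x /f; ring.
have c0B i : `|f i 0| <= B by rewrite (le_trans (norm_coord_le _ _)).
have inc0 tau : 0 <= tau <= 1 -> `|f i0 tau - f i0 0| <= L.
  by move=> ht; rewrite -[L]mul1r; apply: (inc i0 1 tau) => // t _; rewrite mul1r.
have xK t : 0 <= t <= 1 -> 1 <= K1 * x t.
  move=> /inc0; rewrite ler_norml => /andP[h _].
  rewrite -expRD -[leLHS]expR0 ler_expR.
  have := c0B i0; rewrite ler_norml => /andP[h' _].
  by move: (f i0 t) (f i0 0) h h' => a b; lra.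
have divK (a : R) t : 0 <= t <= 1 -> `|x t * a| <= s t -> `|a| <= K1 * s t.
  move=> ht; rewrite normrM (gtr0_norm (x0 t)) => h.
  apply: (@le_trans _ _ (K1 * (x t * `|a|))); last by rewrite ler_pM2l.
  by rewrite mulrA ler_peMl // xK.
have inc12 i tau : 0 <= tau <= 1 ->
    (forall t, `|x t * derive1 (f i) t| <= s t) -> `|f i tau - f i 0| <= K1 * L.
  move=> /andP[tau0 tau1] di.
  apply: inc; [exact: ltW|by rewrite tau0|move=> t /andP[t0 t1]|by []].
  by apply: divK; [rewrite t0 (le_trans t1)|exact: di].
have f1B t : 0 <= t <= 1 -> `|f i1 t| <= `|B| + K1.
  move=> ht; rewrite -[f i1 t](subrK (f i1 0)) addrC (le_trans (ler_normD _ _)) //.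
  apply: lerD; first by rewrite (le_trans (c0B _)) // ler_norm.
  by rewrite (le_trans (inc12 i1 t ht d1)) // ler_piMr // ltW.
have inc3 : `|f i3 1 - f i3 0| <= K3 * L.
  apply: inc => //; [exact: ltW|by rewrite ler01 lexx|move=> t ht].
  have h2 := divK _ t ht (d2 t).
  have h3 : `|derive1 (f i3) t - f i1 t * derive1 (f i2) t| <= K1 ^+ 2 * s t.
    have := d3 t; rewrite expr2 -mulrA => /(divK _ t ht) h.
    have : `|x t * (derive1 (f i3) t - f i1 t * derive1 (f i2) t)| <= K1 * s t by [].
    rewrite normrM (gtr0_norm (x0 t)) => h4.
    apply: (@le_trans _ _
      (K1 * (x t * `|derive1 (f i3) t - f i1 t * derive1 (f i2) t|))).
      by rewrite mulrA ler_peMl // xK.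
    by rewrite expr2 -mulrA ler_pM2l.
  rewrite -[derive1 (f i3) t](subrK (f i1 t * derive1 (f i2) t)).
  rewrite (le_trans (ler_normD _ _)) // /K3 mulrDl lerD // normrM -mulrA.
  by apply: ler_pM => //; exact: f1B.
apply: norm_rV_le.
  by apply: mulr_ge0 => //; apply: addr_ge0; [apply: addr_ge0 => //|]; exact: ltW.
have h01 : 0 <= (1 : R) <= 1 by rewrite ler01 lexx.
have e0 := inc0 1 h01.
have e1 := inc12 i1 1 h01 d1.
have e2 := inc12 i2 1 h01 d2.
have K1L : 0 <= K1 * L by rewrite mulr_ge0 // ltW.
have K3L : 0 <= K3 * L by rewrite mulr_ge0 // ltW.
rewrite mulrDl mulrDl mul1r.
move=> j; have -> : (c 1 - c 0) 0 j = f j 1 - f j 0 by rewrite !mxE.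
move: j; apply: ord4_ind.
- by rewrite (le_trans e0) // -addrA lerDl addr_ge0.
- by rewrite (le_trans e1) // addrAC lerDr addr_ge0.
- by rewrite (le_trans e2) // addrAC lerDr addr_ge0.
- by rewrite (le_trans inc3) // lerDr addr_ge0.
Qed.

Lemma heis_complete : complete_metric heis_metric.
Proof. exact: complete_criterion heis_is_metric heis_lower heis_upper. Qed.

End Metric.

(** * Curvature of the example *)

Section Curvature.
Context {R : realType}.
Variable A : R.
Hypothesis A1 : 1 <= A.
Implicit Types (x : 'rV[R]_4) (a b c k : 'I_4).

Let g := heis_metric A tt.

Let E2 : @fexpr R 4 := sq expu.
Let X : @fexpr R 4 := FV i1.
Let C (t : R) (e : @fexpr R 4) : @fexpr R 4 := FMul (FC t) e.

(** The Christoffel symbols, with upper index k. *)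
Definition heis_gam (k c b : 'I_4) : @fexpr R 4 :=
  match nat_of_ord k, nat_of_ord c, nat_of_ord b with
  | 0, 1, 1 => C (- A^-1) E2
  | 0, 2, 2 => FAdd (C (- A^-1) E2) (C (- A^-1 * 2) (FMul (sq E2) (sq X)))
  | 0, 2, 3 | 0, 3, 2 => C (A^-1 * 2) (FMul (sq E2) X)
  | 0, 3, 3 => C (- A^-1 * 2) (sq E2)
  | 1, 0, 1 | 1, 1, 0 => FC 1
  | 1, 2, 2 => C (-1) (FMul E2 X)
  | 1, 2, 3 | 1, 3, 2 => C (2^-1) E2
  | 2, 0, 2 | 2, 2, 0 => FC 1
  | 2, 1, 2 | 2, 2, 1 => C (2^-1) (FMul E2 X)
  | 2, 1, 3 | 2, 3, 1 => C (- 2^-1) E2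
  | 3, 0, 2 | 3, 2, 0 => C (-1) X
  | 3, 0, 3 | 3, 3, 0 => FC 2
  | 3, 1, 2 | 3, 2, 1 => FAdd (C (2^-1) (FMul E2 (sq X))) (FC (- 2^-1))
  | 3, 1, 3 | 3, 3, 1 => C (- 2^-1) (FMul E2 X)
  | _, _, _ => FC 0
  end%N.

Let A0 : A != 0.
Proof. by rewrite gt_eqF // (lt_le_trans ltr01). Qed.

Lemma heis_coord_metric : coord_metric setT g.
Proof.
have := riemannian_coord_metric (tt : chart (@euclid R 4)) (heis_riemannian A1).
by rewrite image_of_euclid.
Qed.

Lemma mpd_heis c x i j :
  mpd c g x i j = feval (fderiv c (heis_fexpr A i j)) x.
Proof. by rewrite mpdE -pd_feval; apply: eq_pd => y; rewrite mxE. Qed.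

Lemma heis_gamE c x : gam g c x = \matrix_(b, k) feval (heis_gam k c b) x.
Proof.
move: c; apply: (gam_unique heis_coord_metric I) => [b c|c].
  apply/rowP => k; rewrite !mxE.
  by elim/ord4_ind: b; elim/ord4_ind: c; elim/ord4_ind: k.
apply/matrixP => i j; rewrite mpd_heis add_trE !mxE !sum4 !mxE.
elim/ord4_ind: c; elim/ord4_ind: i; elim/ord4_ind: j; rewrite /=;
  move: (expR (x 0 i0)) (x 0 i1) => e z; by field.
Qed.

Lemma heis_christoffel k c b : christoffel g k c b = feval (heis_gam k c b).
Proof.
apply/funext => x; have /matrixP/(_ b k) := heis_gamE c x.
by rewrite !mxE.
Qed.

(** The Ricci tensor is
    -6 du^2 - (4/A + 1/2) e^(2u) (dx^2 + dy^2) + (1/2 - 8/A) e^(4u) (dz - x dy)^2. *)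
Definition heis_ric (a b : 'I_4) : @fexpr R 4 :=
  match nat_of_ord a, nat_of_ord b with
  | 0, 0 => FC (- 6)
  | 1, 1 => C (- (4 / A + 2^-1)) E2
  | 2, 2 => FAdd (C (- (4 / A + 2^-1)) E2)
                 (C (2^-1 - 8 / A) (FMul (sq E2) (sq X)))
  | 2, 3 | 3, 2 => C (8 / A - 2^-1) (FMul (sq E2) X)
  | 3, 3 => C (2^-1 - 8 / A) (sq E2)
  | _, _ => FC 0
  end%N.

Lemma heis_ricci a b x : ricci g a b x = feval (heis_ric a b) x.
Proof.
rewrite /ricci.
under eq_bigr => k _ do rewrite !heis_christoffel !pd_feval.
under [X in _ + X]eq_bigr => k _ do
  under eq_bigr => l _ do rewrite !heis_christoffel.
rewrite !sum4.
elim/ord4_ind: a; elim/ord4_ind: b; rewrite /=;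
  move: (expR (x 0 i0)) (x 0 i1) => e z; by field.
Qed.

(** Matching coefficients in Hess w = (w / m) (Ric - lambda g) for w = e^(ku)
    with k nonzero gives A = 4 + m k, lambda = - 3/2 and m k^2 = (3/2) m k, so
    that k = 3/2. *)
Definition heis_w : @fexpr R 4 := FExp (C (3 / 2) (FV i0)).

Lemma heis_hess m a b x : A = 4 + 3 / 2 * m -> 0 < m ->
  hess g (feval heis_w) a b x =
  feval heis_w x / m * (ricci g a b x - (- (3 / 2)) * g x a b).
Proof.
move=> AE m0; rewrite /hess heis_ricci.
under eq_bigr => k _ do rewrite heis_christoffel pd_feval.
have -> : pd b (feval heis_w) = feval (fderiv b heis_w).
  by apply/funext => y; exact: pd_feval.
rewrite pd_feval sum4 [g x a b]mxE.
have m1 : m != 0 by rewrite gt_eqF.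
have A2 : 8 + 3 * m != 0 by apply: lt0r_neq0; lra.
rewrite /heis_w.
elim/ord4_ind: a; elim/ord4_ind: b; rewrite /= ?AE;
  move: (expR (3 / 2 * _)) (expR (x 0 i0)) (x 0 i1) => w e z;
  by field; rewrite ?m1 ?A2.
Qed.

Definition heis_inv x : 'M[R]_4 := \matrix_(i, j)
  let e := expR (x 0 i0) in let z := x 0 i1 in
  match nat_of_ord i, nat_of_ord j with
  | 0%N, 0%N => A^-1
  | 1%N, 1%N | 2%N, 2%N => e^-1 ^+ 2
  | 2%N, 3%N | 3%N, 2%N => z * e^-1 ^+ 2
  | 3%N, 3%N => e^-1 ^+ 4 + z ^+ 2 * e^-1 ^+ 2
  | _, _ => 0
  end.

Lemma heis_invE x : invmx (g x) = heis_inv x.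
Proof.
have [_ _ ug _] := heis_coord_metric.
rewrite -[RHS](mulKmx (ug x I)).
suff -> : g x *m heis_inv x = 1%:M by rewrite mulmx1.
apply/matrixP => i j; rewrite !mxE sum4 !mxE.
have e0 : expR (x 0 i0) != 0 by rewrite gt_eqF ?expR_gt0.
elim/ord4_ind: i; elim/ord4_ind: j; rewrite /=; move: (expR (x 0 i0)) e0 (x 0 i1)
  => e e0 z; by field; rewrite ?e0.
Qed.

Lemma heis_laplacian x : A = 4 + 3 / 2 ->
  laplacian g (feval heis_w) x = 3 / 2 * feval heis_w x.
Proof.
move=> AE; rewrite /laplacian heis_invE.
have AE' : A = 4 + 3 / 2 * 1 by rewrite mulr1.
under eq_bigr => a _ do under eq_bigr => b _ do
  rewrite (heis_hess a b x AE' ltr01) heis_ricci !mxE.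
rewrite !sum4 /= AE.
have := expR_gt0 (x 0 i0).
move: (feval heis_w x) (expR (x 0 i0)) (x 0 i1) => w e z e0.
by field; rewrite gt_eqF.
Qed.

(** The other Ricci eigenvalues are -(4/A + 1/2) and 1/2 - 8/A. Both differ from
    -6/A by 1/2 - 2/A up to sign, which does not vanish for A > 4. *)
Lemma heis_simple_eigenvalue x : 4 < A ->
  (\rank (ricm g x - (- 6 / A) *: g x)).+1 = 4%N.
Proof.
move=> A4; set M := _ - _.
have e0 : expR (x 0 i0) != 0 by rewrite gt_eqF ?expR_gt0.
pose d : 'rV[R]_4 := delta_mx 0 i0.
have ME i j : M i j = feval (heis_ric i j) x + 6 / A * feval (heis_fexpr A i j) x.
  by rewrite !mxE heis_ricci !mulNr opprK.
have beta0 : 2^-1 - 2 / A != 0.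
  have : 2 / A < 2^-1 by rewrite ltr_pdivrMr; lra.
  by rewrite -subr_gt0 => /lt0r_neq0.
have dM : d *m M = 0.
  apply/rowP => j; rewrite -rowE !mxE heis_ricci.
  elim/ord4_ind: j; rewrite /= ?mulr0 ?subr0 //.
  by rewrite !mulNr opprK mulfVK // addNr.
have Md (v : 'rV[R]_4) : v *m M = 0 -> v = v 0 i0 *: d.
  move=> /rowP vM.
  have E j : v 0 i0 * M i0 j + v 0 i1 * M i1 j + v 0 i2 * M i2 j
      + v 0 i3 * M i3 j = 0.
    by have := vM j; rewrite !mxE sum4 !mxE.
  have := E i1; have := E i2; have := E i3; rewrite !ME /=.
  move: (expR (x 0 i0)) (x 0 i1) e0 => e z e0 E3 E2' E1.
  have bA : (2^-1 - 2 / A) * e ^+ 2 != 0 by rewrite mulf_neq0 ?expf_neq0.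
  have v1 : v 0 i1 = 0.
    apply: (mulfI bA); rewrite mulr0 -[RHS]oppr0 -[in RHS]E1; field.
    exact: A0.
  have v3 : v 0 i3 = z * v 0 i2.
    have b4 : (2^-1 - 2 / A) * e ^+ 4 != 0 by rewrite mulf_neq0 ?expf_neq0.
    apply/eqP; rewrite -subr_eq0; apply/eqP.
    apply: (mulfI b4); rewrite mulr0 -[RHS]E3; field.
    exact: A0.
  have v2 : v 0 i2 = 0.
    move: E2'; rewrite v3 => E2'.
    apply: (mulfI bA); rewrite mulr0 -[RHS]oppr0 -[in RHS]E2'; field.
    exact: A0.
  apply/rowP => j; rewrite !mxE; elim/ord4_ind: j;
    by rewrite ?v3 ?v2 ?v1 /= ?mulr1 ?mulr0.
have kerM : \rank (kermx M) = 1%N.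
  have -> : \rank (kermx M) = \rank d.
    apply/eqP; rewrite eqn_leq; apply/andP; split; apply: mxrankS.
      apply/row_subP => k.
      have := Md (row k (kermx M)); rewrite -row_mul mulmx_ker row0 => ->//.
      exact: scalemx_sub.
    by apply/sub_kermxP.
  exact: mxrank_delta.
have := mxrank_ker M; rewrite kerM.
have := rank_leq_row M; move: (\rank M) => r; lia.
Qed.

End Curvature.

(** * The solvable group *)

Section Group.
Context {R : realType}.
Implicit Types (p q a : 'rV[R]_4).

Let P (j : 'I_4) : @fexpr R (4 + 4) := FV (lshift 4 j).
Let Q (j : 'I_4) : @fexpr R (4 + 4) := FV (rshift 4 j).
Let e : @fexpr R (4 + 4) := FExp (FMul (FC (-1)) (P i0)).

(** The real line acting on the Heisenberg group by dilations, in coordinates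
    where du, e^u dx, e^u dy and e^(2u) (dz - x dy) are left invariant. *)
Definition mul_fexpr (j : 'I_4) : @fexpr R (4 + 4) :=
  match nat_of_ord j with
  | 0 => FAdd (P i0) (Q i0)
  | 1 => FAdd (P i1) (FMul e (Q i1))
  | 2 => FAdd (P i2) (FMul e (Q i2))
  | _ => FAdd (FAdd (P i3) (FMul (FMul e e) (Q i3)))
              (FMul (P i1) (FMul e (Q i2)))
  end%N.

Let E : @fexpr R 4 := FExp (FV i0).
Let N (f : @fexpr R 4) : @fexpr R 4 := FMul (FC (-1)) f.

Definition inv_fexpr (j : 'I_4) : @fexpr R 4 :=
  match nat_of_ord j with
  | 0 => N (FV i0)
  | 1 => N (FMul E (FV i1))
  | 2 => N (FMul E (FV i2))
  | _ => FMul (FMul E E) (FAdd (FMul (FV i1) (FV i2)) (N (FV i3)))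
  end%N.

Definition hmul p q : 'rV[R]_4 := fevals mul_fexpr (row_mx p q).
Definition hinv p : 'rV[R]_4 := fevals inv_fexpr p.

Lemma hmul0 p q : hmul p q 0 i0 = p 0 i0 + q 0 i0.
Proof. by rewrite mxE /= !row_mxEl !row_mxEr. Qed.

Lemma hmul1 p q : hmul p q 0 i1 = p 0 i1 + expR (- p 0 i0) * q 0 i1.
Proof. by rewrite mxE /= !row_mxEl !row_mxEr mulN1r. Qed.

Lemma hmul2 p q : hmul p q 0 i2 = p 0 i2 + expR (- p 0 i0) * q 0 i2.
Proof. by rewrite mxE /= !row_mxEl !row_mxEr mulN1r. Qed.

Lemma hmul3 p q : hmul p q 0 i3 = p 0 i3 + expR (- p 0 i0) ^+ 2 * q 0 i3
   + p 0 i1 * (expR (- p 0 i0) * q 0 i2).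
Proof. by rewrite mxE /= !row_mxEl !row_mxEr mulN1r expr2. Qed.

Definition hmulE := (hmul0, hmul1, hmul2, hmul3).

Lemma hinv0 p : hinv p 0 i0 = - p 0 i0.
Proof. by rewrite mxE /= mulN1r. Qed.

Lemma hinv1 p : hinv p 0 i1 = - (expR (p 0 i0) * p 0 i1).
Proof. by rewrite mxE /= mulN1r. Qed.

Lemma hinv2 p : hinv p 0 i2 = - (expR (p 0 i0) * p 0 i2).
Proof. by rewrite mxE /= mulN1r. Qed.

Lemma hinv3 p : hinv p 0 i3 =
  expR (p 0 i0) ^+ 2 * (p 0 i1 * p 0 i2 - p 0 i3).
Proof. by rewrite mxE /= mulN1r expr2. Qed.

Definition hinvE := (hinv0, hinv1, hinv2, hinv3).

Lemma row4P p q : p 0 i0 = q 0 i0 -> p 0 i1 = q 0 i1 -> p 0 i2 = q 0 i2 ->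
  p 0 i3 = q 0 i3 -> p = q.
Proof. by move=> h0 h1 h2 h3; apply/rowP; exact: ord4_ind. Qed.

Lemma hgroup : is_group hmul hinv 0.
Proof.
split.
- move=> p q r; apply: row4P; rewrite !hmulE ?opprD ?expRD; ring.
- move=> p; apply: row4P; rewrite !hmulE !mxE ?oppr0 ?expR0; ring.
- move=> p; apply: row4P; rewrite !hmulE !hinvE !mxE ?opprK; ring.
Qed.

Lemma hmul_continuous : continuous (fun pq : 'rV[R]_4 * 'rV[R]_4 => hmul pq.1 pq.2).
Proof.
move=> pq.
apply: (@continuous_comp _ _ _ (fun pq : 'rV[R]_4 * 'rV[R]_4 => row_mx pq.1 pq.2)
  (fevals mul_fexpr)); last exact: continuous_fevals.
by apply: continuous_row_mx; [exact: cvg_fst|exact: cvg_snd].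
Qed.

Lemma hlie_group : @lie_group R 4 (euclid 4) hmul hinv 0.
Proof.
split.
- exact: euclid_manifold.
- exact: hgroup.
- split; first exact: hmul_continuous.
  move=> i j.
  have -> : (coords (euclid 4) j \o
        (fun p : prod_atlas (euclid 4) (euclid 4) => hmul p.1 p.2)) \o
      param (prod_atlas (euclid 4) (euclid 4)) i = fevals mul_fexpr.
    by apply/funext => v /=; rewrite /hmul hsubmxK.
  exact: smooth_fevals.
- split; first exact: continuous_fevals.
  by move=> i j; exact: smooth_fevals.
Qed.

Definition lmul_fexpr a (j : 'I_4) : @fexpr R 4 :=
  match nat_of_ord j with
  | 0%N => FAdd (FC (a 0 i0)) (FV i0)
  | 1%N => FAdd (FC (a 0 i1)) (FMul (FC (expR (- a 0 i0))) (FV i1))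
  | 2%N => FAdd (FC (a 0 i2)) (FMul (FC (expR (- a 0 i0))) (FV i2))
  | _ => FAdd (FAdd (FC (a 0 i3))
                    (FMul (FMul (FC (expR (- a 0 i0))) (FC (expR (- a 0 i0))))
                          (FV i3)))
              (FMul (FC (a 0 i1)) (FMul (FC (expR (- a 0 i0))) (FV i2)))
  end.

Lemma hmul_lmul a : hmul a = fevals (lmul_fexpr a).
Proof.
by apply/funext => q; apply: row4P; rewrite !hmulE mxE /= ?expr2.
Qed.

Lemma heis_left_invariant (A : R) :
  @left_invariant R 4 (euclid 4) hmul (heis_metric A).
Proof.
move=> a; rewrite hmul_lmul; split.
  split; first exact: continuous_fevals.
  by move=> i j; exact: smooth_fevals.
move=> i j q _ _ /=.
rewrite (_ : _ \o _ = fevals (lmul_fexpr a)) //.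
rewrite jacobianE; last exact: differentiable_fevals.
have a0 : expR (a 0 i0) != 0 by rewrite gt_eqF ?expR_gt0.
apply/matrixP => b c; rewrite !mxE sum4 !mxE !sum4 !jac_fevals !mxE.
elim/ord4_ind: b; elim/ord4_ind: c; rewrite /= !mxE /= ?expRD ?expRN;
  move: (expR (a 0 i0)) a0 (expR (q 0 i0)) (a 0 i1) (q 0 i1) => ea a0 eq x y;
  by field; rewrite ?a0.
Qed.

(** Bounds each term of the derived series by the previous bound. *)
Lemma commutator_subgroup_sub (A B H : set 'rV[R]_4) :
  A `<=` B -> is_subgroup hmul hinv 0 H ->
  (forall x y, B x -> B y -> H (hmul (hmul x y) (hmul (hinv x) (hinv y)))) ->
  commutator_subgroup hmul hinv 0 A `<=` H.
Proof. by move=> AB sH cH z; apply => // x y /AB Bx /AB By; exact: cH. Qed.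

(** The derived series is contained in the Heisenberg group u = 0, then in its
    centre, and then is trivial. *)
Lemma hsolvable : solvable_group hmul hinv 0.
Proof.
pose H1 := [set p : 'rV[R]_4 | p 0 i0 = 0].
pose H2 := [set p : 'rV[R]_4 | [/\ p 0 i0 = 0, p 0 i1 = 0 & p 0 i2 = 0]].
exists 3; rewrite /=.
apply: (@commutator_subgroup_sub _ H2); last 2 first.
- split=> //= [x y -> ->|x ->]; apply: row4P; rewrite ?hmulE ?hinvE !mxE; ring.
- move=> x y [x0 x1 x2] [y0 y1 y2]; apply: row4P;
    rewrite !hmulE !hinvE ?x0 ?y0 ?x1 ?y1 ?x2 ?y2 !mxE
      ?oppr0 ?addr0 ?oppr0 ?expR0; ring.
apply: (@commutator_subgroup_sub _ H1); last 2 first.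
- split; first by rewrite /H2 /= !mxE.
    move=> x y [x0 x1 x2] [y0 y1 y2].
    by split; rewrite !hmulE ?x0 ?x1 ?x2 ?y0 ?y1 ?y2; ring.
  move=> x [x0 x1 x2]; split; rewrite !hinvE ?x0 ?x1 ?x2; ring.
- move=> x y x0 y0; rewrite /H1 /= in x0 y0.
  by split; rewrite !hmulE !hinvE x0 y0 ?oppr0 ?addr0 ?oppr0 ?expR0; ring.
apply: (@commutator_subgroup_sub _ setT) => //.
- split; first by rewrite /H1 /= mxE.
    by move=> x y x0 y0; rewrite /H1 /= in x0 y0 *; rewrite hmulE x0 y0 addr0.
  by move=> x x0; rewrite /H1 /= in x0 *; rewrite hinvE x0 oppr0.
- by move=> x y _ _; rewrite /H1 /= !hmulE !hinvE; ring.
Qed.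

Lemma connected_rV n : connected [set: 'rV[R]_n].
Proof.
have -> : [set: 'rV[R]_n] =
    \bigcup_(p in [set: 'rV[R]_n]) ((fun t : R => t *: p) @` `[0, 1]).
  apply/seteqP; split => // p _; exists p => //; exists 1; last by rewrite scale1r.
  by rewrite /= in_itv /= ler01 lexx.
apply: bigcup_connected.
  exists 0 => p _; exists 0; last by rewrite scale0r.
  by rewrite /= in_itv /= lexx ler01.
move=> p _; apply: connected_continuous_connected; first exact: segment_connected.
apply: continuous_subspaceT => t; exact: scalel_continuous.
Qed.

End Group.

Theorem theorem1p4 (R : realType) (m : R) (m_gt0 : 0 < m) :
  exists (G : atlas R 4) (mul : G -> G -> G) (inv : G -> G) (e : G)
    (g : metric G),
    [/\ lie_group mul inv e, solvable_group mul inv e, is_metric g,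
        left_invariant mul g &
        exists (lam : R) (w : G -> R),
          lam_einstein lam m g w /\ ~ rigid g].
Proof.
pose A := 4 + 3 / 2 * m.
have A4 : 4 < A by rewrite /A ltrDl mulr_gt0.
have A1 : 1 <= A by rewrite (le_trans _ (ltW A4)) // ler1n.
exists (euclid 4), hmul, hinv, 0, (heis_metric A); split.
- exact: hlie_group.
- exact: hsolvable.
- exact: heis_is_metric.
- exact: heis_left_invariant.
exists (- (3 / 2)), (feval heis_w); split; last first.
  apply: (@simple_eigenvalue_not_rigid R 4 (euclid 4) _ (0 : 'rV[R]_4) (- 6 / A)).
  - exact: heis_riemannian.
  - by rewrite mulNr oppr_eq0 mulf_neq0 // invr_eq0 gt_eqF // (lt_trans _ A4).
  - by move=> [] x _; exact: heis_simple_eigenvalue.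
split.
- split; [by []|exact: heis_riemannian|exact: connected_rV|exact: heis_complete].
- by move=> i; exact: (@smooth_feval R 4 _ heis_w).
- by move=> [] x a b _; exact: heis_hess.
- by move=> p; exact: expR_gt0.
- move=> m1 [] x _; rewrite opprK; apply: heis_laplacian => //.
  by rewrite /A m1 mulr1.
Qed.
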